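(* There is a pro-$2$ group $G$ which satisfies weak Massey vanishing for every $n\geq 3$ with respect to every prime number, but does not satisfy strong Massey vanishing for $n=4$ with respect to $2$.
   Context: Massey products. Let $p$ be a prime, let $G$ be a profinite group, and let $\mathcal C^*$ be the differential graded associative algebra of continuous (inhomogeneous) cochains of $G$ with coefficients in $\mathbb Z/p$ (trivial action), with cup product $\cup$, differential $\delta$, and cohomology $H^*=H^*(G,\mathbb Z/p)$. Let $n\geq 2$ and $a_1,\ldots,a_n\in H^1(G,\mathbb Z/p)$. A defining system for the $n$-fold Massey product of $a_1,\ldots,a_n$ is a family of elements $a_{ij}\in\mathcal C^1$, indexed by $1\leq i<j\leq n+1$ with $(i,j)\neq(1,n+1)$, such that $$\delta(a_{ij})=\sum_{k=i+1}^{j-1}a_{ik}\cup a_{kj}$$ and such that $a_{12},a_{23},\ldots,a_{n,n+1}$ represent $a_1,a_2,\ldots,a_n$. The $n$-fold Massey product of $a_1,\ldots,a_n$ is defined if a defining system exists. The $n$-fold Massey product with respect to a defining system is the class of $\sum_{k=2}^n a_{1k}\cup a_{k,n+1}$ in $H^2(G,\mathbb Z/p)$. The set $\langle a_1,\ldots,a_n\rangle\subseteq H^2(G,\mathbb Z/p)$ consists of the Massey products with respect to all defining systems. The $n$-fold Massey product of $a_1,\ldots,a_n$ vanishes if $0\in\langle a_1,\ldots,a_n\rangle$. $G$ satisfies weak Massey vanishing for $n$ with respect to $p$ if for all $a_1,\ldots,a_n\in H^1(G,\mathbb Z/p)$ whose $n$-fold Massey product is defined, the $n$-fold Massey product of $a_1,\ldots,a_n$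 vanishes. $G$ satisfies strong Massey vanishing for $n$ with respect to $p$ if for all $a_1,\ldots,a_n\in H^1(G,\mathbb Z/p)$ with $a_i\cup a_{i+1}=0$ for every $1\leq i<n$, the $n$-fold Massey product of $a_1,\ldots,a_n$ vanishes. *)

(* Defs.v *)
From HB Require Import structures.
From mathcomp Require Import all_boot all_order all_algebra.
From mathcomp Require Import generic_quotient ring_quotient.
From mathcomp Require Import all_classical topology separation_axioms.
From mathcomp Require Import function_spaces.

Set Implicit Arguments.
Unset Strict Implicit.
Unset Printing Implicit Defensive.

Import GRing.Theory.

Local Open Scope classical_set_scope.
Local Open Scope card_scope.
Local Open Scope ring_scope.
Local Open Scope quotient_scope.

HB.mixin Record isTopologicalGroup G of Topological G & Group G := {
  mulg_continuous : continuous (fun x : G * G => (x.1 * x.2)%g);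
  invg_continuous : continuous (fun x : G => (x^-1)%g)
}.

#[short(type="topologicalGroupType")]
HB.structure Definition TopologicalGroup :=
  {G of isTopologicalGroup G & Topological G & Group G}.

Definition profinite (G : topologicalGroupType) : Prop :=
  [/\ compact [set: G], hausdorff_space G & totally_disconnected [set: G]].

Definition open_normal_subgroup (G : topologicalGroupType) (N : set G) : Prop :=
  [/\ open N, N 1%g, forall x y, N x -> N y -> N (x / y)%g
    & forall x y, N x -> N (x ^ y)%g].

Definition left_cosets (G : topologicalGroupType) (N : set G) : set (set G) :=
  range (fun x : G => [set (x * y)%g | y in N]).

Definition pro_p_group (p : nat) (G : topologicalGroupType) : Prop :=
  profinite G /\
  forall N : set G, open_normal_subgroup N ->
    exists k : nat, left_cosets N #= `I_(p ^ k)%N.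

Section Cochains.
Variables (p : nat) (G : topologicalGroupType).

Definition continuous_cochain n : {pred ('I_n -> G) -> 'F_p} := fun f =>
  `[< continuous (f : {ptws 'I_n -> G} -> discrete_topology 'F_p) >].

Lemma continuous_cochainP n (f : ('I_n -> G) -> 'F_p) :
  reflect (forall x : {ptws 'I_n -> G}, \forall y \near x, f y = f x)
          (f \in @continuous_cochain n).
Proof.
have E x := @discrete_cvg (discrete_topology 'F_p)
  (f @ nbhs (x : {ptws 'I_n -> G})) (f x) _.
by apply: (iffP (asboolP _)) => cf x; apply/E; exact: cf.
Qed.

Lemma continuous_cochain_zmod_closed n : zmod_closed (@continuous_cochain n).
Proof.
split=> [|f h /continuous_cochainP cf /continuous_cochainP ch].
  by apply/continuous_cochainP => x; apply: (@nearW _ (nbhs x)).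
apply/continuous_cochainP => x; move: (cf x) (ch x).
by apply: (@filterS2 _ (nbhs x)) => y fyx hyx; rewrite !fctE fyx hyx.
Qed.

HB.instance Definition _ n := GRing.isZmodClosed.Build _ (@continuous_cochain n)
  (@continuous_cochain_zmod_closed n).

Record cochain n := Cochain {
  cochain_fun :> ('I_n -> G) -> 'F_p;
  cochain_funP : cochain_fun \in @continuous_cochain n }.

HB.instance Definition _ n := [isSub for @cochain_fun n].
HB.instance Definition _ n := [Choice of cochain n by <:].
HB.instance Definition _ n := [SubChoice_isSubZmodule of cochain n by <:].

(* The i-th face of the bar construction (g_1, ..., g_{n+1}): it drops g_1 if
   i = 0, multiplies g_i and g_{i+1} if 1 <= i <= n, and drops g_{n+1} if
   i = n + 1; tuples are indexed from 0. *)
Definition face n (i : nat) (g : 'I_n.+1 -> G) : 'I_n -> G := fun j =>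
  let x := g (widen_ord (leqnSn n) j) in
  let y := g (lift ord0 j) in
  if (j.+1 < i)%N then x else if j.+1 == i then (x * y)%g else y.

Definition differential_fun n (f : ('I_n -> G) -> 'F_p) :
    ('I_n.+1 -> G) -> 'F_p :=
  fun g => \sum_(i < n.+2) (-1) ^+ i * f (face i g).

Definition cup_fun m n (f : ('I_m -> G) -> 'F_p) (h : ('I_n -> G) -> 'F_p) :
    ('I_(m + n) -> G) -> 'F_p :=
  fun g => f (fun i => g (lshift n i)) * h (fun i => g (rshift m i)).

Lemma continuous_ptws (T : topologicalType) n (u : T -> {ptws 'I_n -> G}) :
  (forall i, continuous (fun x => u x i)) -> continuous u.
Proof.
move=> cu x; apply/cvg_sup => i.
exact: (@continuous_comp_initial _ _ _ (fun h : 'I_n -> G => h i) u (cu i) x).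
Qed.

Lemma continuous_coord n (i : 'I_n) :
  continuous (fun g : {ptws 'I_n -> G} => g i).
Proof. exact: (@proj_continuous _ (fun=> G : topologicalType) i). Qed.

Lemma continuous_face n i :
  continuous (@face n i : {ptws 'I_n.+1 -> G} -> {ptws 'I_n -> G}).
Proof.
apply: continuous_ptws => j; rewrite /face.
case: (j.+1 < i)%N; first exact: continuous_coord.
case: (j.+1 == i); last exact: continuous_coord.
move=> g; apply: (@continuous_comp _ _ _
  (fun g : {ptws 'I_n.+1 -> G} => (g (widen_ord (leqnSn n) j), g (lift ord0 j)))
  (fun x : G * G => (x.1 * x.2)%g)); last exact: mulg_continuous.
apply: (@cvg_pair _ _ _ (nbhs g) (nbhs (g (widen_ord (leqnSn n) j)))
  (nbhs (g (lift ord0 j)))); exact: continuous_coord.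
Qed.

Lemma continuous_cochain_comp m n (u : {ptws 'I_m -> G} -> {ptws 'I_n -> G}) f :
  continuous u -> f \in @continuous_cochain n ->
  f \o u \in @continuous_cochain m.
Proof.
move=> cu /continuous_cochainP cf; apply/continuous_cochainP => x.
exact: (cu x _ (cf (u x))).
Qed.

Lemma differential_funP n (f : cochain n) :
  differential_fun f \in @continuous_cochain n.+1.
Proof.
apply/continuous_cochainP => x; rewrite /differential_fun.
have cf (i : 'I_n.+2) : \forall y \near x, f (face i y) = f (face i x).
  have := continuous_cochain_comp (@continuous_face n i) (cochain_funP f).
  by move/continuous_cochainP; apply.
apply: (@filterS _ (nbhs x) _ _ _ _ (@filter_forall _ _ _ (nbhs x) _ cf)).
move=> y fyx.
by apply: eq_bigr => i _; rewrite fyx.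
Qed.

Lemma cup_funP m n (f : cochain m) (h : cochain n) :
  cup_fun f h \in @continuous_cochain (m + n).
Proof.
have cl : continuous ((fun (g : 'I_(m + n) -> G) (i : 'I_m) => g (lshift n i)) :
    {ptws 'I_(m + n) -> G} -> {ptws 'I_m -> G}).
  by apply: continuous_ptws => i; exact: continuous_coord.
have cr : continuous ((fun (g : 'I_(m + n) -> G) (i : 'I_n) => g (rshift m i)) :
    {ptws 'I_(m + n) -> G} -> {ptws 'I_n -> G}).
  by apply: continuous_ptws => i; exact: continuous_coord.
apply/continuous_cochainP => x.
have /continuous_cochainP/(_ x) := continuous_cochain_comp cl (cochain_funP f).
have /continuous_cochainP/(_ x) := continuous_cochain_comp cr (cochain_funP h).
by apply: (@filterS2 _ (nbhs x)) => y /= hyx fyx; rewrite /cup_fun fyx hyx.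
Qed.

Definition differential n (f : cochain n) : cochain n.+1 :=
  Cochain (differential_funP f).

Definition cup m n (f : cochain m) (h : cochain n) : cochain (m + n) :=
  Cochain (cup_funP f h).

Lemma cochain_eq n (f h : cochain n) : f =1 h -> f = h.
Proof. by move=> fh; apply/val_inj/funext. Qed.

Lemma differential_zmod_morphism n : zmod_morphism (@differential n).
Proof.
move=> f h; apply: cochain_eq => g.
change (differential_fun (f - h) g
  = differential_fun f g - differential_fun h g).
rewrite /differential_fun -sumrB; apply: eq_bigr => i _.
by rewrite -mulrBr.
Qed.

HB.instance Definition _ n :=
  GRing.isZmodMorphism.Build (cochain n) (cochain n.+1) (@differential n)
    (@differential_zmod_morphism n).

(* The two summands of the Leibniz rule live in degrees m.+1 + n and m + n.+1,
   which are not convertible, so the rule is stated pointwise. *)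
Lemma leibniz m n (f : cochain m) (h : cochain n) (g : 'I_(m + n).+1 -> G) :
  differential (cup f h) g =
    differential f (fun i : 'I_m.+1 => g (lshift n i)) *
      h (fun j : 'I_n => g (rshift m.+1 j)) +
    (-1) ^+ m * f (fun i : 'I_m => g (widen_ord (leqW (leq_addr n m)) i)) *
      differential h
        (fun j : 'I_n.+1 => g (cast_ord (addnS m n) (rshift m j))).
Proof.
set u := (fun i : 'I_m.+1 => _); set v0 := (fun j : 'I_n => _).
set u0 := (fun i : 'I_m => _); set v := (fun j : 'I_n.+1 => _).
have gE (i j : 'I_(m + n).+1) : i = j :> nat -> g i = g j.
  by move=> ij; congr (g _); exact: val_inj.
have faceL i : (i <= m)%N -> (fun j => face i g (lshift n j)) = face i u.
  by move=> im; apply/funext => j; rewrite /face /u /=; do 2?case: ifP => _;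
    rewrite ?(gE (widen_ord _ _) (lshift n (widen_ord (leqnSn m) j)))
      ?(gE (lift _ _) (lshift n (lift ord0 j))).
have faceL0 i : (i <= m)%N -> (fun j => face i g (rshift m j)) = v0.
  move=> im; apply/funext => j; rewrite /face /v0 /=.
  have ij : (i < (m + j).+1)%N by rewrite ltnS (leq_trans im) ?leq_addr.
  by rewrite ltnNge (ltnW ij) (gtn_eqF ij); exact: gE.
have faceR0 i : (m < i)%N -> (fun j => face i g (lshift n j)) = u0.
  move=> im; apply/funext => j; rewrite /face /u0 /=.
  by rewrite (leq_ltn_trans (ltn_ord j) im); exact: gE.
have faceR k : (fun j => face (m + k) g (rshift m j)) = face k v.
  apply/funext => j; rewrite /face /v /=.
  rewrite -addnS ltn_add2l eqn_add2l; do 2?case: ifP => _.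
  - exact: gE.
  - by congr (_ * _)%g; apply: gE; rewrite //= /bump !leq0n addnCA.
  - by apply: gE; rewrite /= /bump !leq0n addnCA.
have faceU : face m.+1 u = u0.
  by apply/funext => j; rewrite /face /u /u0 /= ltnS ltn_ord; exact: gE.
have faceV : face 0 v = v0.
  by apply/funext => j; rewrite /face /v /v0 /=; apply: gE;
    rewrite /= /bump !leq0n addnCA.
pose t i := (-1) ^+ i * (f (fun j => face i g (lshift n j)) *
                         h (fun j => face i g (rshift m j))) : 'F_p.
transitivity (\sum_(i < (m + n).+2) t i); first by [].
rewrite -(big_mkord xpredT t) (@big_cat_nat _ _ _ m.+1) //=; last first.
  by rewrite ltnS ltnW // ltnS leq_addr.
have -> : \sum_(0 <= i < m.+1) t i =
    (differential f u - (-1) ^+ m.+1 * f u0) * h v0.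
  rewrite /= /differential_fun big_ord_recr /= faceU addrK.
  rewrite big_mkord mulr_suml; apply: eq_bigr => i _.
  by rewrite /t faceL -1?ltnS // faceL0 -1?ltnS // mulrA.
have -> : \sum_(m.+1 <= i < (m + n).+2) t i =
    (-1) ^+ m * f u0 * (differential h v - h v0).
  rewrite /= /differential_fun big_ord_recl /= faceV expr0 mul1r.
  rewrite addrAC subrr add0r mulr_sumr -{1}[m.+1]add0n big_addn.
  have -> : ((m + n).+2 - m.+1 = n.+1)%N by rewrite subSS -addnS addKn.
  rewrite big_mkord; apply: eq_bigr => k _.
  rewrite /t faceR0 ?leq_addl // [(k + _)%N]addnC addSnnS faceR exprD.
  exact: mulrACA.
rewrite exprS; set a := f u0; set b := h v0; set s := _ ^+ m.
by rewrite mulN1r mulNr opprK mulrDl mulrBr addrACA subrr addr0.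
Qed.

Definition is_cocycle n : {pred cochain n} := fun f => differential f == 0.

Lemma is_cocycle_zmod_closed n : zmod_closed (@is_cocycle n).
Proof.
split=> [|f h /eqP df /eqP dh]; apply/eqP; first by rewrite raddf0.
by rewrite raddfB /= df dh subrr.
Qed.

HB.instance Definition _ n :=
  GRing.isZmodClosed.Build _ (@is_cocycle n) (@is_cocycle_zmod_closed n).

Record cocycle n := Cocycle {
  cocycle_cochain :> cochain n;
  cocycle_cochainP : cocycle_cochain \in @is_cocycle n }.

HB.instance Definition _ n := [isSub for @cocycle_cochain n].
HB.instance Definition _ n := [Choice of cocycle n by <:].
HB.instance Definition _ n := [SubChoice_isSubZmodule of cocycle n by <:].

Lemma cocycle_eq n (f h : cocycle n) : f =1 h -> f = h.
Proof. by move=> /cochain_eq; exact: val_inj. Qed.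

Definition is_coboundary n : {pred cocycle n} :=
  match n return pred (cocycle n) with
  | 0 => fun z => z == 0
  | m.+1 => fun z => `[< exists b : cochain m, differential b = z >]
  end.

Lemma is_coboundary_zmod_closed n : zmod_closed (@is_coboundary n).
Proof.
case: n => [|n]; first by split=> [|f h /eqP-> /eqP->]; rewrite ?subrr; apply/eqP.
split=> [|f h /asboolP[b db] /asboolP[c dc]]; apply/asboolP.
  by exists 0; rewrite raddf0.
by exists (b - c); rewrite raddfB /= db dc.
Qed.

HB.instance Definition _ n :=
  GRing.isZmodClosed.Build _ (@is_coboundary n) (@is_coboundary_zmod_closed n).

Definition cohomology n : Type := {ideal_quot @is_coboundary n}.

HB.instance Definition _ n := GRing.Zmodule.on (cohomology n).
HB.instance Definition _ n := EqQuotient.on (cohomology n).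

Lemma cup_cocycleP m n (f : cocycle m) (h : cocycle n) :
  cup f h \in @is_cocycle (m + n).
Proof.
apply/eqP/cochain_eq => g; rewrite leibniz.
rewrite (eqP (cocycle_cochainP f)) (eqP (cocycle_cochainP h)).
by rewrite mul0r mulr0 addr0.
Qed.

Definition cup_cocycle m n (f : cocycle m) (h : cocycle n) : cocycle (m + n) :=
  Cocycle (cup_cocycleP f h).

Definition cup_cohomology m n (a : cohomology m) (b : cohomology n) :
    cohomology (m + n) :=
  \pi_(cohomology (m + n)) (cup_cocycle (repr a) (repr b)).

Lemma is_coboundary_cast m n (e : m.+1 = n) (z : cocycle n) (b : cochain m) :
  (forall g, z g = differential b (fun i => g (cast_ord e i))) ->
  z \in @is_coboundary n.
Proof.
case: n / e z => z zb; apply/asboolP; exists b; apply: cochain_eq => g.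
by rewrite zb; congr (_ _); apply/funext => i; rewrite cast_ord_id.
Qed.

Lemma cup_coboundaryl m n (f : cocycle m) (h : cocycle n) :
  f \in @is_coboundary m -> cup_cocycle f h \in @is_coboundary (m + n).
Proof.
case: m f => [|m] f.
  move=> /eqP ->; suff -> : cup_cocycle (0 : cocycle 0) h = 0 by exact: rpred0.
  by apply: cocycle_eq => g; exact: mul0r.
move=> /asboolP[b db].
apply: (@is_coboundary_cast (m + n) _ (erefl _) _ (cup b h)) => g.
rewrite leibniz (eqP (cocycle_cochainP h)) mulr0 addr0 db.
have gE (i j : 'I_(m + n).+1) : i = j :> nat -> g i = g j
  by move=> ij; congr (g _); exact: val_inj.
by congr (_ * _); congr (cochain_fun _ _); apply/funext => i; exact: gE.
Qed.

Lemma cup_coboundaryr m n (f : cocycle m) (h : cocycle n) :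
  h \in @is_coboundary n -> cup_cocycle f h \in @is_coboundary (m + n).
Proof.
case: n h => [|n] h.
  move=> /eqP ->; suff -> : cup_cocycle f (0 : cocycle 0) = 0 by exact: rpred0.
  by apply: cocycle_eq => g; exact: mulr0.
move=> /asboolP[b db].
apply: (@is_coboundary_cast (m + n) _ (esym (addnS m n)) _
  (if odd m then - cup f b else cup f b)) => g.
have -> (c : cochain (m + n)) g' :
    differential (if odd m then - c else c) g' =
    (-1) ^+ m * differential c g'.
  rewrite -signr_odd; case: (odd m); last by rewrite mul1r.
  by rewrite raddfN mulN1r.
rewrite leibniz (eqP (cocycle_cochainP f)) mul0r add0r db -mulrA signrMK.
have gE (i j : 'I_(m + n.+1)) : i = j :> nat -> g i = g j
  by move=> ij; congr (g _); exact: val_inj.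
by congr (_ * _); congr (cochain_fun _ _); apply/funext => i; exact: gE.
Qed.

Lemma pi_cup m n (f : cocycle m) (h : cocycle n) :
  cup_cohomology (\pi_(cohomology m) f) (\pi_(cohomology n) h) =
  \pi_(cohomology (m + n)) (cup_cocycle f h).
Proof.
rewrite /cup_cohomology; set f' := repr _; set h' := repr _.
have ff' : f' - f \in @is_coboundary m.
  by rewrite Quotient.idealrBE reprK.
have hh' : h' - h \in @is_coboundary n.
  by rewrite Quotient.idealrBE reprK.
apply/eqP; rewrite -Quotient.idealrBE.
have -> : cup_cocycle f' h' - cup_cocycle f h =
    cup_cocycle (f' - f) h' + cup_cocycle f (h' - h).
  apply: cocycle_eq => g.
  rewrite /= /cup_fun.
  pose u := (fun i : 'I_m => g (lshift n i)).
  pose v := (fun i : 'I_n => g (rshift m i)).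
  change (f' u * h' v - f u * h v =
    (f' u - f u) * h' v + f u * (h' v - h v)).
  by rewrite mulrBl mulrBr addrA subrK.
by apply: rpredD; [exact: cup_coboundaryl|exact: cup_coboundaryr].
Qed.

(* The cochain f is a cocycle whose class is c. *)
Definition represents n (f : cochain n) (c : cohomology n) : Prop :=
  exists2 z : cocycle n, cocycle_cochain z = f & \pi_(cohomology n) z = c.

(* Indices start at 0: the classes are a_0, ..., a_{n-1} and the entries are
   A i j with 0 <= i < j <= n and (i, j) <> (0, n); the other values of A are
   irrelevant. *)
Definition defining_system n (a : 'I_n -> cohomology 1)
    (A : nat -> nat -> cochain 1) : Prop :=
  (forall i j, (i < j <= n)%N -> (i, j) != (0, n)%N ->
     differential (A i j) = \sum_(i.+1 <= k < j) cup (A i k) (A k j)) /\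
  (forall i : 'I_n, represents (A i i.+1) (a i)).

Lemma cochain_sumE n (s : seq nat) (F : nat -> cochain n) g :
  (\sum_(i <- s) F i : cochain n) g = \sum_(i <- s) F i g.
Proof.
elim: s => [|x s IH]; first by rewrite !big_nil.
by rewrite !big_cons -IH.
Qed.

Lemma massey_cocycle n a (A : nat -> nat -> cochain 1) :
  @defining_system n a A ->
  differential (\sum_(1 <= k < n) cup (A 0%N k) (A k n) : cochain 2) = 0.
Proof.
case=> dA _; rewrite raddf_sum /=; apply: cochain_eq => g.
rewrite /index_iota cochain_sumE.
pose x (i : 'I_3) := (fun _ : 'I_1 => g i).
pose F k l := A 0%N k (x ord0) * A k l (x (inord 1)) * A l n (x (inord 2)).
have x0 (u : 'I_1 -> G) (i : 'I_3) : u ord0 = g i -> u = x i.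
  by move=> ui; apply/funext => j; rewrite ord1 /x ui.
transitivity (\sum_(1 <= k < n) (\sum_(1 <= l < k) F l k -
    \sum_(k.+1 <= l < n) F k l)).
  apply: eq_big_nat => k /andP[k1 kn].
  rewrite (@leibniz 1 1) dA ?k1 1?ltnW //; last first.
    by rewrite xpair_eqE negb_and (ltn_eqF kn) orbT.
  rewrite (dA k n) ?kn ?leqnn //; last by rewrite xpair_eqE negb_and (gtn_eqF k1).
  rewrite /index_iota !cochain_sumE /F mulr_suml expr1 mulN1r mulNr mulr_sumr.
  have gE (i j : 'I_3) : i = j :> nat -> g i = g j by move/val_inj->.
  congr (_ - _); apply: eq_bigr => l _; rewrite /= /cup_fun.
    by congr (_ * _ * _); congr (cochain_fun _ _);
      apply: x0; apply: gE; rewrite /= ?inordK.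
  rewrite mulrA.
  by congr (_ * _ * _); congr (cochain_fun _ _);
      apply: x0; apply: gE; rewrite /= ?inordK.
rewrite sumrB; apply/eqP; rewrite subr_eq0; apply/eqP.
transitivity (\sum_(1 <= k < n) \sum_(1 <= l < n | (l < k)%N) F l k).
  by apply: eq_big_nat => k /andP[k1 kn]; rewrite (big_nat_widen _ _ n) // ltnW.
rewrite (exchange_big_dep_nat xpredT) //=; apply: eq_big_nat => k /andP[k1 kn].
by rewrite [RHS](big_nat_widenl _ 1%N).
Qed.

Lemma massey_class n a (A : nat -> nat -> cochain 1) :
  @defining_system n a A ->
  exists c, represents (\sum_(1 <= k < n) cup (A 0%N k) (A k n) : cochain 2) c.
Proof.
by move=> /massey_cocycle/eqP dA; eexists; exists (Cocycle dA).
Qed.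

Definition massey_defined n (a : 'I_n -> cohomology 1) : Prop :=
  exists A, defining_system a A.

Definition massey_product n (a : 'I_n -> cohomology 1) : set (cohomology 2) :=
  [set c | exists2 A, defining_system a A &
    represents (\sum_(1 <= k < n) cup (A 0%N k) (A k n) : cochain 2) c].

Definition massey_vanishes n (a : 'I_n -> cohomology 1) : Prop :=
  massey_product a 0.

End Cochains.

Definition weak_massey_vanishing (p : nat) (G : topologicalGroupType)
    (n : nat) : Prop :=
  forall a : 'I_n -> cohomology p G 1, massey_defined a -> massey_vanishes a.

Definition strong_massey_vanishing (p : nat) (G : topologicalGroupType)
    (n : nat) : Prop :=
  forall a : 'I_n -> cohomology p G 1,
    (forall i j : 'I_n, j = i.+1 :> nat -> cup_cohomology (a i) (a j) = 0) ->
    massey_vanishes a.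

(* Main.v *)
(* A defining system over F_2 is a homomorphism from G to the unitriangular
   group U_(n+1)(F_2) modulo its center (the top right corner) with prescribed
   superdiagonal, and the Massey product vanishes for a suitable defining
   system iff some homomorphism to U_(n+1)(F_2) has this superdiagonal.

   G is the pro-2 group with generators b, c, e, f and u_k, v_k (k natural,
   u_k and v_k converging to 1) and relations
     c e = e c prod_k u_k^2,   b f = f b prod_k v_k^2,   b c f = c b e,
   so that f is e times a commutator of b and c.

   Let x and y be the characters dual to b and c.  Consecutive terms of the
   sequence x + y, x, y, x + y have zero cup product, but 5 x 5 unitriangular
   matrices with this superdiagonal cannot satisfy the relations modulo the
   corner: the entries (1, 4) and (0, 3) of the first two relations kill the
   entry (1, 3) of e and of f, while the commutator of b and c has entry 1
   there.  The squares do not help, being trivial modulo the corner.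

   For n >= 4, every homomorphism modulo the corner can be corrected: almost all
   u_k act trivially, and giving one of them the value 1 + E_(0,2) + E_(2,n),
   of square 1 + E_(0,n) and zero superdiagonal, repairs the first relation;
   similarly for the v_k, and f repairs the third one.  For n = 3 the corner is
   repaired by changing the entries (0, 2) and (1, 3) of the matrices.

   For odd p there is nothing to do, as H^1(G, Z/p) = 0. *)
Require Import Defs.
From HB Require Import structures.
From mathcomp Require Import all_boot all_algebra all_fingroup cyclic pgroup.
From mathcomp Require Import ring generic_quotient ring_quotient.
From mathcomp Require Import all_classical topology separation_axioms.
From mathcomp Require Import function_spaces.

Set Implicit Arguments.
Unset Strict Implicit.
Unset Printing Implicit Defensive.

Import GRing.Theory.

Local Open Scope ring_scope.

(** * Unitriangular matrices over F_2 *)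

Definition unitriangular n (A : 'M['F_2]_n.+1) : bool :=
  [forall i : 'I_n.+1, forall j : 'I_n.+1, (j <= i)%N ==> (A i j == (i == j)%:R)].

Lemma unitriangularP n (A : 'M['F_2]_n.+1) :
  reflect (forall i j : 'I_n.+1, (j <= i)%N -> A i j = (i == j)%:R)
          (unitriangular A).
Proof.
apply: (iffP forallP) => uA i.
  by move=> j ji; apply/eqP; exact: (implyP (forallP (uA i) j)).
by apply/forallP => j; apply/implyP => ji; rewrite uA.
Qed.

Lemma unitriangular_unit n (A : 'M['F_2]_n.+1) : unitriangular A -> A \in unitmx.
Proof.
move=> /unitriangularP uA; rewrite unitmxE -det_tr det_trig ?unitfE.
  by rewrite big1 ?oner_eq0 // => i _; rewrite mxE uA // eqxx.
by apply/is_trig_mxP => i j ij; rewrite mxE uA ?(ltnW ij) // -val_eqE gtn_eqF.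
Qed.

Lemma unitriangularM n (A B : 'M['F_2]_n.+1) :
  unitriangular A -> unitriangular B -> unitriangular (A *m B).
Proof.
move=> /unitriangularP uA /unitriangularP uB; apply/unitriangularP => i j ji.
rewrite mxE (bigD1 i) //= uA // eqxx mul1r uB // big1 ?addr0 // => k ki.
have [ik|ki'] := ltnP i k; first by rewrite uB ?(leq_trans ji (ltnW ik)) //
  -val_eqE gtn_eqF ?mulr0 // (leq_ltn_trans ji ik).
by rewrite uA // eq_sym (negPf ki) mul0r.
Qed.

Definition unitriangular_set n : {set {'GL_n.+1['F_2]}} :=
  [set A | unitriangular (GLval A)].

Lemma unitriangular_group_set n : group_set (unitriangular_set n).
Proof.
apply/group_setP; split=> [|A B]; rewrite !inE.
  by apply/unitriangularP => i j _; rewrite GL_1E mxE.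
by rewrite GL_ME; exact: unitriangularM.
Qed.

Canonical unitriangular_group n := Group (unitriangular_group_set n).

(* Matrices of size n + 1, with rows and columns numbered from 0 to n. *)
Definition UT n : finGroupType := subg_of (unitriangular_group n).

(* Locked, as unification may otherwise compute in 'F_2 without end. *)
HB.lock Definition ent n (x : UT n) (i j : nat) : 'F_2 :=
  GLval (sgval x) (inord i) (inord j).

Lemma ent_trig n (x : UT n) (i j : nat) :
  (j <= i <= n)%N -> ent x i j = (i == j)%:R.
Proof.
move=> /andP[ji ile]; rewrite ent.unlock; have := subgP x.
rewrite inE => /unitriangularP ->.
  by rewrite -val_eqE /= !inordK // ltnS // (leq_trans ji).
by rewrite !inordK // ltnS // (leq_trans ji).
Qed.

Lemma ent_ext n (x y : UT n) :
  (forall i j, (i < j <= n)%N -> ent x i j = ent y i j) -> x = y.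
Proof.
move=> xy; apply/val_inj/val_inj/matrixP => i j /=.
suff: ent x i j = ent y i j by rewrite ent.unlock !inord_val.
have [ij|ji] := ltnP i j; first by rewrite xy // ij -ltnS ltn_ord.
by rewrite !ent_trig // ji -ltnS ltn_ord.
Qed.

Lemma ent1 n i j : (i < j <= n)%N -> ent (1%g : UT n) i j = 0.
Proof.
move=> /andP[ij jn]; rewrite ent.unlock GL_1E mxE -val_eqE /= !inordK ?ltnS //.
  by rewrite ltn_eqF.
exact: leq_trans (ltnW ij) jn.
Qed.

Lemma entM n (x y : UT n) i j : (i < j <= n)%N ->
  ent (x * y)%g i j =
    ent x i j + ent y i j + \sum_(i.+1 <= k < j) ent x i k * ent y k j.
Proof.
move=> /andP[ij jn]; have ile := leq_trans (ltnW ij) jn.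
rewrite {1}ent.unlock (_ : GLval _ = GLval (sgval x) *m GLval (sgval y)) // mxE.
transitivity (\sum_(0 <= k < n.+1) ent x i k * ent y k j).
  by rewrite big_mkord; apply: eq_bigr => k _; rewrite ent.unlock inord_val.
rewrite (@big_cat_nat _ _ _ i) //=; last exact: leqW.
rewrite big_nat big1 ?add0r; last first.
  by move=> k /andP[_ ki]; rewrite ent_trig ?gtn_eqF ?mul0r // (ltnW ki).
rewrite big_ltn ?ltnS // ent_trig ?leqnn // eqxx mul1r.
rewrite (@big_cat_nat _ _ _ j) //=; last exact: leqW.
rewrite (@big_ltn _ _ _ j n.+1) ?ltnS //= [ent y j j]ent_trig ?leqnn // eqxx mulr1.
have -> : \sum_(j.+1 <= k < n.+1) ent x i k * ent y k j = 0.
  rewrite big_nat big1 // => k /andP[jk kn].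
  by rewrite [ent y k j]ent_trig ?(gtn_eqF jk) ?mulr0 // (ltnW jk).
by rewrite addr0 addrCA addrC -!addrA [RHS]addrCA.
Qed.

(** The default values of [insubd] and [subg] are never taken: the matrix is unitriangular, hence
    invertible. *)
HB.lock Definition mkUT n (a : nat -> nat -> 'F_2) : UT n :=
  let A := \matrix_(i < n.+1, j < n.+1)
    if (i < j)%N then a i j else (i == j)%:R in
  subg _ (insubd (1%g : {'GL_n.+1['F_2]}) A).

Lemma ent_mkUT n a i j : (i < j <= n)%N -> ent (mkUT n a) i j = a i j.
Proof.
move=> /andP[ij jn]; have ile := leq_trans (ltnW ij) jn.
rewrite ent.unlock mkUT.unlock; set A := \matrix_(_, _) _.
have uA : unitriangular A.
  by apply/unitriangularP => k l lk; rewrite mxE ltnNge lk.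
have vA : GLval (insubd (1%g : {'GL_n.+1['F_2]}) A) = A.
  by rewrite [LHS]val_insubd unitriangular_unit.
by rewrite subgK ?inE vA // mxE !inordK ?ltnS // ij.
Qed.

(** Each squaring clears one more superdiagonal: an entry of [y * y] is twice that of [y] plus
    products of entries nearer to the diagonal. *)
Lemma UT_exp2 n (x : UT n) k : (n <= k)%N -> (x ^+ (2 ^ k))%g = 1%g.
Proof.
move=> nk.
have low m i j : (i < j <= n)%N -> (j <= i + m)%N ->
    ent (x ^+ (2 ^ m))%g i j = 0.
  elim: m i j => [|m IH] i j; first by rewrite addn0 => /andP[ij _]; rewrite leqNgt ij.
  move=> ijn jm; rewrite expnSr expgM expgS expg1 entM // big_nat big1 => [|l /andP[il lj]].
    by rewrite addr0 -mulr2n -mulr_natl pchar_Fp_0 ?mul0r.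
  rewrite IH ?mul0r //; first by move: ijn => /andP[_ jn]; rewrite il (leq_trans (ltnW lj)).
  by rewrite -ltnS -addnS (leq_trans lj).
apply: ent_ext => i j ijn; rewrite low ?ent1 //.
by move: ijn => /andP[_ jn]; rewrite (leq_trans jn) // (leq_trans nk) // leq_addl.
Qed.

Lemma UT_pgroup n : (2.-group [set: UT n])%g.
Proof.
apply/pgroupP => q q_pr /(Cauchy q_pr)[x _ ox].
have : (#[x]%g %| 2 ^ n)%N by rewrite order_dvdn UT_exp2.
by rewrite ox Euclid_dvdX // => /andP[]; rewrite dvdn_prime2 // inE => /eqP->.
Qed.

(** * Congruence modulo the central corner entry *)

Definition eqmodZ n (x y : UT n) : Prop :=
  forall i j, (i < j <= n)%N -> (i, j) != (0, n)%N -> ent x i j = ent y i j.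

Definition corner n (c : 'F_2) : UT n :=
  mkUT n (fun i j => if (i == 0%N) && (j == n) then c else 0).

Lemma ent_corner n c i j : (i < j <= n)%N ->
  ent (corner n c) i j = if (i == 0%N) && (j == n) then c else 0.
Proof. exact: ent_mkUT. Qed.

Lemma ent_mul_corner n (x : UT n) c i j : (i < j <= n)%N ->
  ent (x * corner n c)%g i j =
    ent x i j + if (i == 0%N) && (j == n) then c else 0.
Proof.
move=> ijn; rewrite entM // ent_corner // big_nat big1 ?addr0 // => k /andP[ik kj].
rewrite ent_corner ?kj ?(andP ijn).2 //.
by rewrite (gtn_eqF (leq_ltn_trans (leq0n i) ik)) mulr0.
Qed.

Lemma cornerC n (x : UT n) c : (corner n c * x = x * corner n c)%g.
Proof.
apply: ent_ext => i j ijn; have [ij jn] := andP ijn.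
rewrite ent_mul_corner // entM // ent_corner // big_nat big1 => [|k].
  by rewrite addr0 addrC.
move=> /andP[ik kj]; rewrite ent_corner ?ik ?(leq_trans (ltnW kj)) //.
by rewrite [k == n]ltn_eqF ?andbF ?mul0r // (leq_trans kj).
Qed.

Lemma cornerD n c d : (corner n c * corner n d = corner n (c + d)%R)%g.
Proof.
apply: ent_ext => i j ijn; rewrite ent_mul_corner // !ent_corner //.
by case: ifP => // _; rewrite addr0.
Qed.

Lemma corner0 n : corner n 0 = 1%g.
Proof. by apply: ent_ext => i j ijn; rewrite ent_corner // ent1 // if_same. Qed.

Lemma F2_addrr (c : 'F_2) : c + c = 0.
Proof. by case: c => -[|[|//]] ?; apply/val_inj. Qed.

Lemma F2_oppr (c : 'F_2) : - c = c.
Proof. by apply/eqP; rewrite -subr_eq0 -opprD F2_addrr oppr0. Qed.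

Lemma F2_neq0 (c : 'F_2) : c != 0 -> c = 1.
Proof. by case: c => -[|[|//]] // ? _; apply/val_inj. Qed.

Lemma eqmodZ_corner n (x y : UT n) : eqmodZ x y ->
  exists c, x = (y * corner n c)%g.
Proof.
move=> xy; exists (ent x 0 n - ent y 0 n); apply: ent_ext => i j ijn.
rewrite ent_mul_corner //; case: ifP => [/andP[/eqP-> /eqP->]|].
  by rewrite addrC subrK.
by rewrite -xpair_eqE => /negbT/xy-> //; rewrite addr0.
Qed.

Lemma eqmodZ_mul_corner n (x : UT n) c : eqmodZ (x * corner n c)%g x.
Proof.
move=> i j ijn; rewrite xpair_eqE => /negPf nc.
by rewrite ent_mul_corner // nc addr0.
Qed.

Lemma eqmodZ_refl n (x : UT n) : eqmodZ x x. Proof. by []. Qed.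
Lemma eqmodZ_sym n (x y : UT n) : eqmodZ x y -> eqmodZ y x.
Proof. by move=> xy i j ijn c; rewrite xy. Qed.
Lemma eqmodZ_trans n (y x z : UT n) : eqmodZ x y -> eqmodZ y z -> eqmodZ x z.
Proof. by move=> xy yz i j ijn c; rewrite xy ?yz. Qed.

Lemma eqmodZM n (x x' y y' : UT n) :
  eqmodZ x x' -> eqmodZ y y' -> eqmodZ (x * y)%g (x' * y')%g.
Proof.
move=> /eqmodZ_corner[c ->] /eqmodZ_corner[d ->].
rewrite -mulgA [(corner n c * _)%g]cornerC -!mulgA cornerD mulgA.
exact: eqmodZ_mul_corner.
Qed.

Lemma eqmodZ_prod n (I : Type) (s : seq I) (F H : I -> UT n) :
  (forall i, eqmodZ (F i) (H i)) ->
  eqmodZ (\prod_(i <- s) F i)%g (\prod_(i <- s) H i)%g.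
Proof.
move=> FH; elim: s => [|i s IH]; first by rewrite !big_nil.
by rewrite !big_cons; exact: eqmodZM.
Qed.

Definition eqdiag n (x y : UT n) : Prop :=
  forall i, (i < n)%N -> ent x i i.+1 = ent y i i.+1.

Lemma entM_diag n (x y : UT n) i : (i < n)%N ->
  ent (x * y)%g i i.+1 = ent x i i.+1 + ent y i i.+1.
Proof. by move=> lin; rewrite entM ?ltnS ?leqnn // big_geq ?addr0. Qed.

Lemma eqmodZ_diag n (x y : UT n) : (1 < n)%N -> eqmodZ x y -> eqdiag x y.
Proof.
move=> n1 xy i lin; apply: xy; rewrite ?ltnS ?leqnn //.
by rewrite xpair_eqE negb_and; case: i lin => //= _; rewrite ltn_eqF.
Qed.

(* The values of the generators of G under a continuous homomorphism to UT n:
   as u_k and v_k converge to 1, the products in the relations are finite. *)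
Record relsys n := RelSys {
  rb : UT n; rc : UT n; re : UT n; rf : UT n;
  ru : nat -> UT n; rv : nat -> UT n;
  rbound : nat;
  ru_fin : forall k, (rbound <= k)%N -> ru k = 1%g;
  rv_fin : forall k, (rbound <= k)%N -> rv k = 1%g;
  rel_ce : (rc * re = re * rc * \prod_(0 <= k < rbound) (ru k * ru k))%g;
  rel_bf : (rb * rf = rf * rb * \prod_(0 <= k < rbound) (rv k * rv k))%g;
  rel_ef : (rb * rc * rf = rc * rb * re)%g }.

(** * Repairing the relations for [n >= 4] *)

Definition square_root_corner n : UT n :=
  mkUT n (fun i j => ((i == 0%N) && (j == 2%N) || (i == 2%N) && (j == n))%:R).

Lemma square_root_cornerE n : (4 <= n)%N ->
  (square_root_corner n * square_root_corner n = corner n 1%R)%g.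
Proof.
move=> n4; apply: ent_ext => i j ijn; rewrite entM // F2_addrr add0r ent_corner //.
have [ij jn] := andP ijn.
rewrite (eq_big_nat _ _ (F2 := fun k =>
  if (i == 0%N) && (j == n) && (k == 2%N) then 1 else 0)); last first.
  move=> k /andP[ik kj]; rewrite !ent_mkUT ?ik ?kj ?(leq_trans (ltnW kj)) //.
  rewrite -natrM mulnb (gtn_eqF (leq_ltn_trans (leq0n i) ik)) /=.
  rewrite [k == n]ltn_eqF ?andbF ?orbF //; last exact: leq_trans jn.
  by case: (i == _); case: (k == _); case: (j == _).
case: ifP => /= [/andP[/eqP-> /eqP->]|_]; last by rewrite big1.
rewrite (@big_cat_nat _ _ _ 2) //=; last exact: leq_trans n4.
rewrite big_nat1 add0r big_ltn ?eqxx; last exact: leq_trans n4.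
rewrite big_nat big1 ?addr0 // => k /andP[k2 _].
by rewrite gtn_eqF.
Qed.

(** For [n = 3] the entry [(2, n)] would lie on the superdiagonal, and using this matrix would
    change the given classes. *)
Lemma square_root_corner_diag n : (4 <= n)%N -> eqdiag (square_root_corner n) 1%g.
Proof.
move=> n4 i lin; rewrite ent1 ?ltnS ?leqnn // ent_mkUT ?ltnS ?leqnn //.
by case: i lin => [|[|[|i]]] //= _; rewrite ltn_eqF.
Qed.

Section Lift.
Variables (n : nat) (b c e f : UT n) (u v : nat -> UT n) (K : nat).
Hypothesis ce : eqmodZ (c * e)%g (e * c * \prod_(0 <= k < K) (u k * u k))%g.
Hypothesis bf : eqmodZ (b * f)%g (f * b * \prod_(0 <= k < K) (v k * v k))%g.
Hypothesis ef : eqmodZ (b * c * f)%g (c * b * e)%g.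

(** Only the superdiagonal is kept, as it carries the classes of the Massey product; every other
    entry may be corrected. *)
Definition lifts (t : relsys n) : Prop :=
  [/\ eqdiag (rb t) b, eqdiag (rc t) c, eqdiag (re t) e & eqdiag (rf t) f] /\
  forall k, [/\ eqdiag (ru t k) (if (k < K)%N then u k else 1%g)
              & eqdiag (rv t k) (if (k < K)%N then v k else 1%g)].

(** The index [K] is a spare one: the generator placed there has the defect [corner n d] as its
    square. *)
Let extend (d : 'F_2) (w : nat -> UT n) k : UT n :=
  if (k < K)%N then w k
  else if (k == K) && (d != 0) then square_root_corner n else 1%g.

Lemma extend_fin d w k : (K.+1 <= k)%N -> extend d w k = 1%g.
Proof. by move=> Kk; rewrite /extend ltnNge (ltnW Kk) (gtn_eqF Kk). Qed.

Lemma extend_diag d w k : (4 <= n)%N ->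
  eqdiag (extend d w k) (if (k < K)%N then w k else 1%g).
Proof.
by move=> n4; rewrite /extend; case: ifP => // _; case: ifP => // _;
  exact: square_root_corner_diag.
Qed.

Lemma extend_prod d w : (4 <= n)%N ->
  (\prod_(0 <= k < K.+1) (extend d w k * extend d w k) =
   \prod_(0 <= k < K) (w k * w k) * corner n d)%g.
Proof.
move=> n4; rewrite big_nat_recr //=; congr (_ * _)%g.
  by apply: eq_big_nat => k /andP[_ kK]; rewrite /extend kK.
rewrite /extend ltnn eqxx /=; have [->|d0] := eqVneq d 0.
  by rewrite corner0 mulg1.
by rewrite square_root_cornerE // (F2_neq0 d0).
Qed.

Lemma lift_ge4 : (4 <= n)%N -> exists t, lifts t.
Proof.
move=> n4; have [d1 ce1] := eqmodZ_corner ce; have [d2 bf2] := eqmodZ_corner bf.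
have [d3 ef3] := eqmodZ_corner ef.
have ce' : (c * e = e * c * \prod_(0 <= k < K.+1) (extend d1 u k * extend d1 u k))%g.
  by rewrite extend_prod // mulgA.
(* The correction [corner n d3] of [f], made for the third relation, is central and so occurs
   equally on both sides here. *)
have bf' : (b * (f * corner n d3) = f * corner n d3 * b *
    \prod_(0 <= k < K.+1) (extend d2 v k * extend d2 v k))%g.
  by rewrite extend_prod // mulgA bf2 -!mulgA cornerD addrC -cornerD !mulgA
    -[(f * corner n d3 * b)%g]mulgA cornerC !mulgA; congr (_ * _)%g;
    rewrite -!mulgA; congr (_ * (_ * _))%g; rewrite cornerC.
have ef' : (b * c * (f * corner n d3) = c * b * e)%g.
  by rewrite mulgA ef3 -mulgA cornerD F2_addrr corner0 mulg1.
exists (RelSys (extend_fin d1 u) (extend_fin d2 v) ce' bf' ef').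
split=> [|k]; first split => //=; last by split; exact: extend_diag.
move=> i lin; rewrite ent_mul_corner ?ltnS ?leqnn //; case: ifP; rewrite ?addr0 //.
by move=> /andP[/eqP i0 /eqP n1]; move: n4; rewrite -[X in (_ < X)%N]n1 i0.
Qed.

End Lift.

(** * Repairing the relations for [n = 3] *)

Lemma UT3_ext (x y : UT 3) :
  ent x 0 1 = ent y 0 1 -> ent x 1 2 = ent y 1 2 -> ent x 2 3 = ent y 2 3 ->
  ent x 0 2 = ent y 0 2 -> ent x 1 3 = ent y 1 3 -> ent x 0 3 = ent y 0 3 ->
  x = y.
Proof.
move=> e01 e12 e23 e02 e13 e03; apply: ent_ext => i j.
by case: i => [|[|[|i]]]; case: j => [|[|[|[|j]]]] //=; rewrite ?andbF.
Qed.

Section UTM.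
Variables (n : nat) (x y : UT n).

Lemma entM2 i : (i.+1 < n)%N ->
  ent (x * y)%g i i.+2 =
    ent x i i.+2 + ent y i i.+2 + ent x i i.+1 * ent y i.+1 i.+2.
Proof. by move=> lin; rewrite entM ?big_nat1 // ltnS leqnSn. Qed.

Lemma entM3 i : (i.+2 < n)%N ->
  ent (x * y)%g i i.+3 = ent x i i.+3 + ent y i i.+3 +
    (ent x i i.+1 * ent y i.+1 i.+3 + ent x i i.+2 * ent y i.+2 i.+3).
Proof.
move=> lin; have ii : (i < i.+3)%N by rewrite ltnS -addn2 leq_addr.
by rewrite entM ?ii // big_ltn ?leqnSn // big_nat1.
Qed.

End UTM.

(** These matrices form the derived subgroup of [UT 3], which is abelian; multiplying by them leaves
    the superdiagonal unchanged. *)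
Definition deep (a b c : 'F_2) : UT 3 := mkUT 3 (fun i j =>
  if (i == 0%N) && (j == 2%N) then a
  else if (i == 1%N) && (j == 3%N) then b
  else if (i == 0%N) && (j == 3%N) then c else 0).

Lemma deepE a b c : [/\ ent (deep a b c) 0 1 = 0, ent (deep a b c) 1 2 = 0
  & ent (deep a b c) 2 3 = 0] /\ [/\ ent (deep a b c) 0 2 = a,
  ent (deep a b c) 1 3 = b & ent (deep a b c) 0 3 = c].
Proof. by do 2!split; rewrite ent_mkUT. Qed.

(** Moving [deep a b c] past [y] produces their commutator, a corner that depends only on the outer
    superdiagonal entries of [y]. *)
Lemma deepM (x y : UT 3) a b c a' b' c' :
  (x * deep a b c * (y * deep a' b' c') = x * y *
    deep (a + a')%R (b + b')%R
      (c + c' + (a * ent y 2 3 - b * ent y 0 1))%R)%g.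
Proof.
have [[p1 p2 p3] [p4 p5 p6]] := deepE a b c.
have [[q1 q2 q3] [q4 q5 q6]] := deepE a' b' c'.
set d := deep (a + a') _ _; have [[]] := deepE (a + a') (b + b')
  (c + c' + (a * ent y 2 3 - b * ent y 0 1)).
rewrite -/d => d1 d2 d3 [d4 d5 d6].
by apply: UT3_ext; do ?[rewrite entM_diag //|rewrite entM2 //|rewrite entM3 //];
  rewrite ?p1 ?p2 ?p3 ?p4 ?p5 ?p6
  ?q1 ?q2 ?q3 ?q4 ?q5 ?q6 ?d1 ?d2 ?d3 ?d4 ?d5 ?d6; ring.
Qed.

Lemma deep0 : deep 0 0 0 = 1%g.
Proof.
by have [[p1 p2 p3] [p4 p5 p6]] := deepE 0 0 0; apply: UT3_ext;
  rewrite ?p1 ?p2 ?p3 ?p4 ?p5 ?p6 ent1.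
Qed.

Lemma deepD a b c a' b' c' :
  (deep a b c * deep a' b' c' = deep (a + a')%R (b + b')%R (c + c')%R)%g.
Proof.
have := deepM 1 1 a b c a' b' c'; rewrite !mul1g !ent1 // !mulr0 subrr addr0.
exact.
Qed.

Lemma deep_corner c : corner 3 c = deep 0 0 c.
Proof.
have [[p1 p2 p3] [p4 p5 p6]] := deepE 0 0 c.
by apply: UT3_ext; rewrite ?p1 ?p2 ?p3 ?p4 ?p5 ?p6 ent_corner.
Qed.

Lemma eqmodZ_deep (x y : UT 3) : eqmodZ x y -> exists c, x = (y * deep 0 0 c)%g.
Proof. by move=> /eqmodZ_corner[c ->]; exists c; rewrite deep_corner. Qed.

Lemma eqdiag_deep (x : UT 3) a b c : eqdiag (x * deep a b c)%g x.
Proof.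
move=> i i3; have [[p1 p2 p3] _] := deepE a b c; rewrite entM_diag //.
by case: i i3 => [|[|[|]]] // _; rewrite ?p1 ?p2 ?p3 addr0.
Qed.

Section Lift3.
Variables (b c e f : UT 3) (u v : nat -> UT 3) (K : nat).
Hypothesis ce : eqmodZ (c * e)%g (e * c * \prod_(0 <= k < K) (u k * u k))%g.
Hypothesis bf : eqmodZ (b * f)%g (f * b * \prod_(0 <= k < K) (v k * v k))%g.
Hypothesis ef : eqmodZ (b * c * f)%g (c * b * e)%g.

Local Notation l x := (ent x 0 1).
Local Notation r x := (ent x 2 3).

Lemma prod_square_diag (w : nat -> UT 3) i : (i < 3)%N ->
  ent (\prod_(0 <= k < K) (w k * w k))%g i i.+1 = 0.
Proof.
move=> i3; elim/big_ind: _ => [|x y x0 y0|k _]; first by rewrite ent1 ?ltnS ?leqnn.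
  by rewrite entM_diag // x0 y0 addr0.
by rewrite entM_diag // F2_addrr.
Qed.

Lemma ef_diag : eqdiag f e.
Proof.
move=> i i3; have [d3 /(congr1 (fun x => ent x i i.+1))] := eqmodZ_deep ef.
rewrite (eqdiag_deep (c * b * e)%g 0 0 d3) // !entM_diag // [_ + ent b _ _]addrC.
exact: addrI.
Qed.

(** The corner of the shift is 0, since a corner factor is central of order at most 2 and disappears
    from the square. *)
Definition shift (w : nat -> UT 3) (a b : nat -> 'F_2) k : UT 3 :=
  if (k < K)%N then (w k * deep (a k) (b k) 0)%g else 1%g.

Lemma shift_fin w a b' k : (K <= k)%N -> shift w a b' k = 1%g.
Proof. by rewrite /shift ltnNge => ->. Qed.

Lemma shift_diag w a b' k : eqdiag (shift w a b' k) (if (k < K)%N then w k else 1%g).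
Proof. by rewrite /shift; case: ifP => // _; exact: eqdiag_deep. Qed.

Lemma shift_prod w a b' :
  (\prod_(0 <= k < K) (shift w a b' k * shift w a b' k) =
  \prod_(0 <= k < K) (w k * w k) *
    deep 0 0 (\sum_(0 <= k < K) (a k * r (w k) - b' k * l (w k)))%R)%g.
Proof.
rewrite (eq_big_nat _ _ (F2 := fun k => w k * w k *
    deep 0 0 (a k * r (w k) - b' k * l (w k))%R)%g); last first.
  by move=> k /andP[_ kK]; rewrite /shift kK deepM !F2_addrr add0r.
elim: K => [|k IH]; first by rewrite !big_nil deep0 mulg1.
rewrite !big_nat_recr //= IH deepM !(mul0r, addr0, subr0) //.
Qed.

(** Multiplying the generators by deep elements affects the first two relations in the corner only,
    and linearly; the two equations say that the defects [d1] and [d2] are compensated. The third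
    relation forces the shifts of [e] and [f] to share their entries (0, 2) and (1, 3). *)
Lemma lift3_shift aB bB aC bC aE bE (aU bU aV bV : nat -> 'F_2) d1 d2 :
  (c * e = e * c * \prod_(0 <= k < K) (u k * u k) * deep 0 0 d1)%g ->
  (b * f = f * b * \prod_(0 <= k < K) (v k * v k) * deep 0 0 d2)%g ->
  d1 + (aC * r e - bC * l e) = (aE * r c - bE * l c) +
    \sum_(0 <= k < K) (aU k * r (u k) - bU k * l (u k)) ->
  d2 + (aB * r e - bB * l e) = (aE * r b - bE * l b) +
    \sum_(0 <= k < K) (aV k * r (v k) - bV k * l (v k)) ->
  exists t, lifts b c e f u v K t.
Proof.
move=> ce1 bf1 eq1 eq2; have [d3 ef3] := eqmodZ_deep ef.
(* The corner of the shift of [f], solved from the third relation; being central, it does not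
   disturb the second. *)
pose g := (aC * r b - bC * l b) - (aB * r c - bB * l c) - d3.
pose B := (b * deep aB bB 0)%g; pose C := (c * deep aC bC 0)%g.
pose E := (e * deep aE bE 0)%g; pose F := (f * deep aE bE g)%g.
have CE : (C * E = E * C * \prod_(0 <= k < K) (shift u aU bU k * shift u aU bU k))%g.
  rewrite shift_prod !deepM !prod_square_diag // ce1 -!mulgA !deepD !mulgA.
  congr (_ * deep _ _ _)%g; rewrite ?add0r ?addr0; try by rewrite addrC.
  by rewrite !mulr0 subr0 addr0 -eq1.
have BF : (B * F = F * B * \prod_(0 <= k < K) (shift v aV bV k * shift v aV bV k))%g.
  rewrite shift_prod !deepM !prod_square_diag // bf1 -!mulgA !deepD !mulgA.
  congr (_ * deep _ _ _)%g; rewrite ?add0r ?addr0; try by rewrite addrC.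
  by rewrite !ef_diag // !mulr0 subr0 addr0 addrCA eq2 addrA.
have EF : (B * C * F = C * B * E)%g.
  rewrite !deepM ef3 -!mulgA !deepD !mulgA.
  congr (_ * deep _ _ _)%g; rewrite ?ef_diag //; rewrite /g; ring.
exists (RelSys (@shift_fin u aU bU) (@shift_fin v aV bV) CE BF EF).
split; first by split; exact: eqdiag_deep.
by move=> k; split; exact: shift_diag.
Qed.

(** If some [w k] has a nonzero outer superdiagonal entry, a shift at this single [k] reaches every
    [d]. Otherwise every square is trivial, since each product occurring in it contains an outer
    superdiagonal entry. *)
Lemma shift_sum (w : nat -> UT 3) :
  (forall d, exists a b', \sum_(0 <= k < K) (a k * r (w k) - b' k * l (w k)) = d) \/
  (\prod_(0 <= k < K) (w k * w k))%g = 1%g.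
Proof.
have [/existsP[k wk]|/existsPn w0] :=
    boolP [exists k : 'I_K, (l (w k) != 0) || (r (w k) != 0)]; [left|right].
  move=> d; have sum1 (F : nat -> 'F_2) : (forall j : nat, j != k -> F j = 0) ->
      \sum_(0 <= j < K) F j = F k.
    by move=> F0; rewrite big_mkord (bigD1 k) //= big1 ?addr0 // => j /F0.
  have [rk|rk] := eqVneq (r (w k)) 0; last first.
    exists (fun j : nat => if j == k then d else 0), (fun=> 0).
    rewrite sum1 => [|j /negPf->]; last by rewrite !mul0r subr0.
    by rewrite eqxx (F2_neq0 rk) mulr1 mul0r subr0.
  move: wk; rewrite rk eqxx orbF => lk.
  exists (fun=> 0), (fun j : nat => if j == k then - d else 0).
  rewrite sum1 => [|j /negPf->]; last by rewrite !mul0r subr0.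
  by rewrite eqxx (F2_neq0 lk) mulr1 mul0r opprK add0r.
rewrite big_nat big1 // => k kK; have := w0 (Ordinal kK).
rewrite negb_or !negbK /= => /andP[/eqP l0 /eqP r0].
by apply: UT3_ext; rewrite ?ent1 //; do ?[rewrite entM_diag //|rewrite entM2 //|rewrite entM3 //];
  rewrite ?l0 ?r0 F2_addrr ?mul0r ?mulr0 ?addr0.
Qed.

(* If e has nonzero entry (0, 1) or (2, 3), shifting b and c repairs everything.
   Otherwise shifting e changes the corners of the first two relations by the
   outer superdiagonal entries of c and b, and the u_k and v_k, unless their
   squares are trivial, repair the two corners independently.  If all squares
   are trivial, both corners are determined by e, and shifting e suffices. *)
Lemma lift_3 : exists t, lifts b c e f u v K t.
Proof.
have [d1 ce1] := eqmodZ_deep ce; have [d2 bf2] := eqmodZ_deep bf.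
have lift aB bB aC bC aE bE aU bU aV bV :=
  @lift3_shift aB bB aC bC aE bE aU bU aV bV d1 d2 ce1 bf2.
have sum0 (w : nat -> UT 3) : \sum_(0 <= k < K) (0 * r (w k) - 0 * l (w k)) = 0.
  by rewrite big1 // => k _; rewrite !mul0r subr0.
have [le|le] := eqVneq (l e) 0; last first.
  apply: (lift 0 d2 0 d1 0 0 (fun=> 0) (fun=> 0) (fun=> 0) (fun=> 0));
    by rewrite sum0 (F2_neq0 le); ring.
have [re|re] := eqVneq (r e) 0; last first.
  apply: (lift (- d2) 0 (- d1) 0 0 0 (fun=> 0) (fun=> 0) (fun=> 0) (fun=> 0));
    by rewrite sum0 (F2_neq0 re); ring.
have [d3 ef3] := eqmodZ_deep ef.
have [[k1 k2 k3] [k4 k5 _]] := deepE 0 0 d3.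
have [fe0 fe1 fe2] : [/\ l f = l e, ent f 1 2 = ent e 1 2 & r f = r e].
  by split; exact: ef_diag.
(* The entries (1, 3) and (0, 2) of the third relation express those of [f] by those of [e] and of
   the commutator of [b] and [c]. *)
have f13 : ent f 1 3 = ent e 1 3 + ent c 1 2 * r b - ent b 1 2 * r c.
  have /(congr1 (fun x => ent x 1 3)) := ef3.
  do ?[rewrite entM_diag //|rewrite entM2 //]; rewrite k3 k5 fe2 re => h.
  apply: (addrI (ent b 1 3 + ent c 1 3 + ent b 1 2 * r c)).
  by move: h; rewrite !mulr0 !addr0 => ->; ring.
have f02 : ent f 0 2 = ent e 0 2 + l c * ent b 1 2 - l b * ent c 1 2.
  have /(congr1 (fun x => ent x 0 2)) := ef3.
  do ?[rewrite entM_diag //|rewrite entM2 //]; rewrite k2 k4 fe1 => h.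
  apply: (addrI (ent b 0 2 + ent c 0 2 + l b * ent c 1 2 + (l b + l c) * ent e 1 2)).
  by rewrite addrAC h; ring.
(* For [y] without outer superdiagonal entries and trivial squares, the corner of a commutation
   relation determines its defect. This serves for [c], [e] and for [b], [f]. *)
have corner_eq x y d : l y = 0 -> r y = 0 -> (x * y = y * x * 1 * deep 0 0 d)%g ->
    d = l x * ent y 1 3 - ent y 0 2 * r x.
  move=> ly ry /(congr1 (fun x => ent x 0 3)); rewrite mulg1.
  have [[m1 m2 m3] [m4 m5 m6]] := deepE 0 0 d.
  do ?[rewrite entM_diag //|rewrite entM2 //|rewrite entM3 //].
  rewrite m3 m5 m6 ly ry => h; apply: (addrI (ent x 0 3 + ent y 0 3 + ent y 0 2 * r x)).
  by move: h; rewrite !mulr0 mul0r !addr0 add0r => h; rewrite -[RHS]addrA subrKC h; ring.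
have [Usum|Uprod] := shift_sum u; have [Vsum|Vprod] := shift_sum v.
- have [aU [bU sumU]] := Usum d1; have [aV [bV sumV]] := Vsum d2.
  by apply: (lift 0 0 0 0 0 0 aU bU aV bV); rewrite ?sumU ?sumV; ring.
- have d2E : d2 = l b * ent f 1 3 - ent f 0 2 * r b.
    by apply: corner_eq; rewrite ?fe0 ?fe2 // bf2 Vprod.
  have [aU [bU sumU]] := Usum (d1 - (- ent f 0 2 * r c + ent f 1 3 * l c)).
  by apply: (lift 0 0 0 0 (- ent f 0 2) (- ent f 1 3) aU bU (fun=> 0) (fun=> 0));
    rewrite ?sum0 ?sumU ?d2E; ring.
- have d1E : d1 = l c * ent e 1 3 - ent e 0 2 * r c.
    by apply: corner_eq; rewrite // ce1 Uprod.
  have [aV [bV sumV]] := Vsum (d2 - (- ent e 0 2 * r b + ent e 1 3 * l b)).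
  by apply: (lift 0 0 0 0 (- ent e 0 2) (- ent e 1 3) (fun=> 0) (fun=> 0) aV bV);
    rewrite ?sum0 ?sumV ?d1E; ring.
- have d1E : d1 = l c * ent e 1 3 - ent e 0 2 * r c.
    by apply: corner_eq; rewrite // ce1 Uprod.
  have d2E : d2 = l b * ent f 1 3 - ent f 0 2 * r b.
    by apply: corner_eq; rewrite ?fe0 ?fe2 // bf2 Vprod.
  (* The shifts [- ent e 0 2] and [- ent e 1 3] already solve the first equation. The terms with
     [ent b 1 2] cancel there and, in the second, account for the difference between [f] and [e]. *)
  apply: (lift 0 0 0 0 (- ent e 0 2 + ent b 1 2 * l c) (- ent e 1 3 + ent b 1 2 * r c)
    (fun=> 0) (fun=> 0) (fun=> 0) (fun=> 0)); rewrite sum0.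
    by rewrite d1E; ring.
  apply/eqP; rewrite d2E f13 f02 -subr_eq0.
  (* The two sides differ by twice this expression, which is zero in characteristic 2. *)
  rewrite -[X in _ == X](F2_addrr (l b * ent c 1 2 * r b - l c * ent b 1 2 * r b)).
  by apply/eqP; ring.
Qed.

End Lift3.

(** * The obstruction for [n = 4] *)

Lemma UT4_square (x : UT 4) : eqdiag x 1%g -> eqmodZ (x * x)%g 1%g.
Proof.
move=> x1; have x0 i : (i < 4)%N -> ent x i i.+1 = 0.
  by move=> i4; rewrite x1 // ent1 // leqnn.
(* The nonzero entries of [x - 1] are at distance at least 2 from the diagonal, so those of its
   square, which is [x * x - 1] in characteristic 2, are at distance 4: only the corner is left. *)
move=> [|[|[|[|i]]]] [|[|[|[|[|j]]]]] //=; rewrite ?andbF // => _ _;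
  do ?[rewrite entM_diag //|rewrite entM2 //|rewrite entM3 //];
  by rewrite ?x0 // F2_addrr ent1 // ?mul0r ?mulr0 ?addr0.
Qed.

Lemma no_relsys4 (b c e f : UT 4) (u v : nat -> UT 4) (K : nat) :
  eqmodZ (c * e)%g (e * c * \prod_(0 <= k < K) (u k * u k))%g ->
  eqmodZ (b * f)%g (f * b * \prod_(0 <= k < K) (v k * v k))%g ->
  eqmodZ (b * c * f)%g (c * b * e)%g ->
  eqdiag e 1%g -> (forall k, eqdiag (u k) 1%g) -> (forall k, eqdiag (v k) 1%g) ->
  ent b 0 1 = 1 -> ent b 1 2 = 1 -> ent b 2 3 = 0 ->
  ent c 1 2 = 0 -> ent c 2 3 = 1 -> ent c 3 4 = 1 -> False.
Proof.
move=> ce bf ef e1 u1 v1 b01 b12 b23 c12 c23 c34.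
have prod1 (w : nat -> UT 4) : (forall k, eqdiag (w k) 1%g) ->
    eqmodZ (\prod_(0 <= k < K) (w k * w k))%g 1%g.
  move=> w1; apply: (eqmodZ_trans (y := \prod_(0 <= k < K) 1)%g).
    by apply: eqmodZ_prod => k; exact: UT4_square.
  by rewrite big1.
have {}ce : eqmodZ (c * e)%g (e * c)%g.
  apply: eqmodZ_trans ce _; rewrite -[X in eqmodZ _ X]mulg1.
  by apply: eqmodZM (prod1 _ u1); exact: eqmodZ_refl.
have {}bf : eqmodZ (b * f)%g (f * b)%g.
  apply: eqmodZ_trans bf _; rewrite -[X in eqmodZ _ X]mulg1.
  by apply: eqmodZM (prod1 _ v1); exact: eqmodZ_refl.
have e0 i : (i < 4)%N -> ent e i i.+1 = 0.
  by move=> i4; rewrite e1 // ent1 // leqnn.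
have f0 i : (i < 4)%N -> ent f i i.+1 = 0.
  move=> i4; have := eqmodZ_diag (isT : (1 < 4)%N) ef i4.
  by rewrite !entM_diag // e0 // addr0 [ent b _ _ + _]addrC -[RHS]addr0 => /addrI.
have e13 : ent e 1 3 = 0.
  have := ce 1%N 4%N isT isT; rewrite !entM3 // c12 c34 !e0 //.
  by rewrite mul0r mulr0 !mul0r !add0r mulr1 addr0 [ent e 1 4 + _]addrC -[LHS]addr0 => /addrI.
have f13 : ent f 1 3 = 0.
  have := bf 0%N 3%N isT isT; rewrite !entM3 // b01 b23 !f0 //.
  by rewrite mul1r mulr0 !mul0r mulr0 !addr0 [ent f 0 3 + _]addrC -[RHS]addr0 => /addrI.
(* At the entry (1, 3), [b * c] contributes the product 1 of [b] at (1, 2) and [c] at (2, 3), while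
   [c * b] contributes 0. *)
have := ef 1%N 3%N isT isT; rewrite !entM2 // !e0 // !f0 // e13 f13 b12 c12 b23 c23.
rewrite !mulr0 !mulr1 !addr0 [ent c 1 3 + _]addrC -[RHS]addr0 => /addrI.
by move/eqP; rewrite oner_eq0.
Qed.

(** * Homomorphisms to [UT 2], the source of vanishing cup products *)

Section RelSys2.
Variables b0 b1 c0 c1 : 'F_2.

Definition bidiagonal (x y : 'F_2) : UT 2 := mkUT 2 (fun i j =>
  if (i == 0%N) && (j == 1%N) then x
  else if (i == 1%N) && (j == 2%N) then y else 0).

(** The corner is the commutator of the two matrices. As the value of [f], with [e] trivial, it
    solves the third relation, and being central also the second. *)
Lemma bidiagonal_commutator : (bidiagonal b0 b1 * bidiagonal c0 c1 *
   corner 2 (b0 * c1 + c0 * b1)%R = bidiagonal c0 c1 * bidiagonal b0 b1 * 1)%g.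
Proof.
rewrite mulg1; apply: ent_ext => i j.
case: i => [|[|i]]; case: j => [|[|[|j]]] //=; rewrite ?andbF // => _;
  rewrite ent_mul_corner // !entM //=.
- by rewrite !big_geq // !ent_mkUT //= !addr0 addrC.
- by rewrite !big_nat1 !ent_mkUT //= !add0r addrA F2_addrr add0r.
- by rewrite !big_geq // !ent_mkUT //= !addr0 addrC.
Qed.

Lemma relsys2_ce : (bidiagonal c0 c1 * 1 =
  1 * bidiagonal c0 c1 * \prod_(0 <= k < 0) (1 * 1))%g.
Proof. by rewrite big_nil !mulg1 mul1g. Qed.

Lemma relsys2_bf : (bidiagonal b0 b1 * corner 2 (b0 * c1 + c0 * b1)%R =
  corner 2 (b0 * c1 + c0 * b1)%R * bidiagonal b0 b1 *
    \prod_(0 <= k < 0) (1 * 1))%g.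
Proof. by rewrite big_nil mulg1 cornerC. Qed.

Definition relsys2 : relsys 2 :=
  @RelSys 2 _ _ _ _ (fun=> 1%g) (fun=> 1%g) 0 (fun _ _ => erefl) (fun _ _ => erefl)
    relsys2_ce relsys2_bf bidiagonal_commutator.

End RelSys2.

(** * Closed subgroups of products of finite groups *)

Section ClosedSubgroup.
Local Open Scope classical_set_scope.
Local Open Scope group_scope.
Variables (I : choiceType) (gT : I -> finGroupType).
Variable S : set (forall i, gT i).

Inductive word : (forall i, gT i) -> Prop :=
| word1 : word (fun=> 1)
| word_gen x of S x : word x
| wordM x y of word x & word y : word (fun i => x i * y i)
| wordV x of word x : word (fun i => (x i)^-1).

(* The closure of the subgroup generated by S in the product of the gT i, with
   the topology induced by the product of the discrete topologies. *)
Record closedgen := ClosedGen {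
  coord :> forall i, gT i;
  coordP : forall s : seq I,
    exists2 w, word w & {in s, forall i, coord i = w i} }.

HB.instance Definition _ := gen_eqMixin closedgen.
HB.instance Definition _ := gen_choiceMixin closedgen.

Lemma closedgen_ext (x y : closedgen) : (forall i, x i = y i) -> x = y.
Proof.
case: x y => x xP [y yP] /= xy.
by have {}xy : x = y := functional_extensionality_dep xy; case: y / xy yP => yP;
  congr ClosedGen; exact: Prop_irrelevance.
Qed.

Lemma closedgen1P (s : seq I) : exists2 w, word w & {in s, forall i, 1 = w i}.
Proof. by exists (fun=> 1); first exact: word1. Qed.

Lemma closedgenMP (x y : closedgen) (s : seq I) :
  exists2 w, word w & {in s, forall i, x i * y i = w i}.
Proof.
have [v wv xv] := coordP x s; have [w ww yw] := coordP y s.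
exists (fun i => v i * w i); first exact: wordM.
by move=> i si; rewrite xv ?yw.
Qed.

Lemma closedgenVP (x : closedgen) (s : seq I) :
  exists2 w, word w & {in s, forall i, (x i)^-1 = w i}.
Proof.
have [v wv xv] := coordP x s.
by exists (fun i => (v i)^-1); [exact: wordV | move=> i si; rewrite xv].
Qed.

Definition closedgen1 := ClosedGen closedgen1P.
Definition closedgenM x y := ClosedGen (closedgenMP x y).
Definition closedgenV x := ClosedGen (closedgenVP x).

Lemma closedgenA : associative closedgenM.
Proof. by move=> x y z; apply: closedgen_ext => i /=; rewrite mulgA. Qed.
Lemma closedgen1g : left_id closedgen1 closedgenM.
Proof. by move=> x; apply: closedgen_ext => i /=; rewrite mul1g. Qed.
Lemma closedgeng1 : right_id closedgen1 closedgenM.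
Proof. by move=> x; apply: closedgen_ext => i /=; rewrite mulg1. Qed.
Lemma closedgenVg : left_inverse closedgen1 closedgenV closedgenM.
Proof. by move=> x; apply: closedgen_ext => i /=; rewrite mulVg. Qed.
Lemma closedgengV : right_inverse closedgen1 closedgenV closedgenM.
Proof. by move=> x; apply: closedgen_ext => i /=; rewrite mulgV. Qed.

HB.instance Definition _ := isGroup.Build closedgen
  closedgenA closedgen1g closedgeng1 closedgenVg closedgengV.

Definition agree (s : seq I) (x y : closedgen) := {in s, forall i, x i = y i}.

Definition closedgen_open (A : set closedgen) :=
  forall x, A x -> exists s, agree s x `<=` A.

Lemma closedgen_openT : closedgen_open setT.
Proof. by move=> x _; exists [::]. Qed.

Lemma closedgen_openI : setI_closed closedgen_open.
Proof.
move=> A B oA oB x [/oA[s sA] /oB[t tB]]; exists (s ++ t) => y xy.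
by split; [apply: sA | apply: tB] => i si; apply: xy; rewrite mem_cat si ?orbT.
Qed.

Lemma closedgen_open_bigU (J : Type) (f : J -> set closedgen) :
  (forall i, closedgen_open (f i)) -> closedgen_open (\bigcup_i f i).
Proof.
move=> of_ x [j _ /of_[s sf]]; exists s; apply: (subset_trans sf).
exact: bigcup_sup.
Qed.

HB.instance Definition _ := isOpenTopological.Build closedgen
  closedgen_openT closedgen_openI closedgen_open_bigU.

Lemma nbhs_agree (x : closedgen) (A : set closedgen) :
  nbhs x A <-> exists s, agree s x `<=` A.
Proof.
split=> [[B [oB Bx BA]]|[s sA]].
  by have [s sB] := oB _ Bx; exists s; exact: subset_trans BA.
exists (agree s x); split => // y xy; exists s => z yz i si.
by rewrite xy ?yz.
Qed.

(** A neighbourhood constrains finitely many coordinates only, so the bounds for these have a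
    maximum. *)
Lemma nbhs_eventually (x : closedgen) (y : nat -> closedgen) A : nbhs x A ->
  (forall i, exists m, forall k, (m <= k)%N -> y k i = x i) ->
  exists m, forall k, (m <= k)%N -> A (y k).
Proof.
move=> /nbhs_agree[s sA] yx.
suff [m ym] : exists m, forall k, (m <= k)%N -> agree s x (y k).
  by exists m => k mk; apply: sA; exact: ym.
elim: s {sA} => [|i s [m ym]]; first by exists 0%N.
have [m' yi] := yx i; exists (maxn m m') => k; rewrite geq_max => /andP[mk m'k] j.
by rewrite inE => /orP[/eqP->|js]; [rewrite yi | exact: ym].
Qed.

Lemma closedgen_mulg_continuous :
  continuous (fun x : closedgen * closedgen => x.1 * x.2).
Proof.
move=> [x y] A /nbhs_agree[s sA] /=.
exists (agree s x, agree s y).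
  by split; apply/nbhs_agree; exists s.
by move=> [x' y'] [/= xx' yy']; apply: sA => i si /=; rewrite xx' ?yy'.
Qed.

Lemma closedgen_invg_continuous : continuous (fun x : closedgen => x^-1).
Proof.
move=> x A /nbhs_agree[s sA]; apply/nbhs_agree; exists s => y xy.
by apply: sA => i si; congr (_^-1); exact: xy.
Qed.

HB.instance Definition _ := isTopologicalGroup.Build closedgen
  closedgen_mulg_continuous closedgen_invg_continuous.

Lemma closedgen_zero_dimensional : zero_dimensional closedgen.
Proof.
move=> x y /eqP xy; have [i xyi] : exists i, x i <> y i.
  by apply/existsNP => xyE; apply: xy; exact: closedgen_ext.
have clo c : open [set z : closedgen | z i = c].
  move=> z /= <-; exists [:: i] => w; rewrite /agree => /(_ i).
  by rewrite mem_head => /(_ isT).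
exists [set z : closedgen | z i = x i]; split => //=; last by move/esym.
split; first exact: clo.
rewrite -openC; move=> z /= zx; exists [:: i] => w /(_ i (mem_head _ _)) /= zw.
by rewrite -zw.
Qed.

Lemma closedgen_hausdorff : hausdorff_space closedgen.
Proof.
rewrite open_hausdorff => x y /closedgen_zero_dimensional[U [[oU cU] Ux Uy]].
exists (U, ~` U); rewrite ?inE; split => //=; first by rewrite openC.
by rewrite setICr.
Qed.

Lemma ultra_fiber (F : set_system closedgen) i : UltraFilter F ->
  exists c, F [set x : closedgen | x i = c].
Proof.
move=> UF; apply: contrapT => /forallNP Fc.
have : F [set x : closedgen | forall c, x i <> c].
  apply: (@filter_forall _ _ (fun c => [set x : closedgen | x i <> c])) => c.
  by case: (in_ultra_setVsetC [set x : closedgen | x i = c] UF) => // /Fc.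
by move=> /filter_ex[x] /(_ (x i)).
Qed.

(** As the factors are finite, an ultrafilter fixes each coordinate. The limit values agree on every
    finite set of coordinates with some element, hence with a word, so they define a point. *)
Lemma closedgen_compact : compact [set: closedgen].
Proof.
rewrite compact_ultra => F UF _.
pose c i := sval (cid (ultra_fiber i UF)).
have Fc i : F [set x : closedgen | x i = c i] by rewrite /c; case: cid.
have Fs (s : seq I) : F [set x : closedgen | {in s, forall i, x i = c i}].
  elim: s => [|i s IH]; first by apply: filterS filterT.
  apply: filterS2 (Fc i) IH => x /= xi xs j; rewrite inE => /orP[/eqP->|] //.
  exact: xs.
have cP (s : seq I) : exists2 w, word w & {in s, forall i, c i = w i}.
  have /filter_ex[x /= xs] := Fs s; have [w ww xw] := coordP x s.
  by exists w => // i si; rewrite -xs ?xw.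
exists (ClosedGen cP); split => // A /nbhs_agree[s sA].
by apply: filterS (Fs s) => x xs; apply: sA => i si /=; rewrite xs.
Qed.

Lemma closedgen_profinite : profinite closedgen.
Proof.
split; [exact: closedgen_compact | exact: closedgen_hausdorff |].
exact/zero_dimension_totally_disconnected/closedgen_zero_dimensional.
Qed.

(** An open [N] contains the kernel of the projection [pi] to finitely many coordinates, so its
    cosets can be counted in the image of [pi], a subgroup of a finite [p]-group. *)
Lemma closedgen_pro_p (p : nat) : (forall i, p.-group [set: gT i]%SET) ->
  pro_p_group p closedgen.
Proof.
move=> pgT; split=> [|N [oN N1 Ndiv _]]; first exact: closedgen_profinite.
have [s sN] := oN _ N1.
pose T : finGroupType := {dffun forall j : 'I_(size s), gT (tnth (in_tuple s) j)}.
pose pi (x : closedgen) : T := [ffun j => x (tnth (in_tuple s) j)].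
have piM x y : pi (x * y) = pi x * pi y.
  by apply/ffunP => j; rewrite !ffunE.
have piN x y : pi x = pi y -> N (x^-1 * y).
  move=> /ffunP xy; apply: sN => i si.
  have [j <-] : exists j, tnth (in_tuple s) j = i.
    by have /tnthP[j ->] : i \in in_tuple s by []; exists j.
  have := xy j; rewrite !ffunE => {}xy.
  by rewrite [RHS]/= -xy mulVg.
have NM x y : N x -> N y -> N (x * y).
  by move=> Nx Ny; rewrite -[y]invgK -[y^-1]mul1g; apply: (Ndiv) => //; exact: (Ndiv).
pose H := [set t : T | `[< exists x, pi x = t >]]%SET.
pose M := [set t : T | `[< exists2 x, N x & pi x = t >]]%SET.
have gH : group_set H.
  apply/group_setP; split=> [|a b]; rewrite !inE.
    by exists 1; apply/ffunP => j; rewrite !ffunE.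
  move=> [x <-] [y <-]; exists (x * y).
  exact: piM.
have gM : group_set M.
  apply/group_setP; split=> [|a b]; rewrite !inE.
    by exists 1 => //; apply/ffunP => j; rewrite !ffunE.
  move=> [x Nx <-] [y Ny <-]; exists (x * y).
    exact: NM.
  exact: piM.
(* Preimage under [pi] is a bijection from the cosets of [M] in [H] to those of [N]. *)
pose phi (C : {set T}) : set closedgen := [set x | pi x \in C].
have cosE x : phi (pi x *: M) = [set x * y | y in N].
  apply/seteqP; split=> [y /=|_ [y Ny <-]] /=.
    move=> /lcosetP[m]; rewrite !inE => -[z Nz <-]; rewrite -piM => /piN Nyxz.
    exists (x^-1 * y); last by rewrite mulKVg.
    have -> : x^-1 * y = z * (y^-1 * (x * z))^-1 by rewrite !invMg invgK -mulgA mulKVg.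
    exact: (Ndiv).
  by rewrite /phi /= piM mem_lcoset mulKg !inE; exists y.
have NE : left_cosets N = phi @` [set` lcosets M H].
  apply/seteqP; split=> [_ [x _ <-]|_ [C CH <-]].
    exists (pi x *: M); last exact: cosE.
    by apply/lcosetsP; exists (pi x); rewrite // !inE; exists x.
  have /lcosetsP[t] := CH; rewrite !inE => -[x <-] ->.
  by exists x => //; rewrite cosE.
have phiI : {in [set` lcosets M H] &, injective phi}.
  have sub C D : C \in lcosets M H -> phi C = phi D -> C \subset D.
    move=> /lcosetsP[t tH ->] CD; apply/fintype.subsetP => u utM.
    have /lcosetP[m] := utM; rewrite !inE => -[z _ <-].
    move: tH utM CD; rewrite !inE => -[x <-] + + uE.
    rewrite {u}uE -piM => xM CD.
    by have : phi (pi x *: M) (x * z) by []; rewrite CD.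
  move=> C D /set_mem CH /set_mem DH CD; apply/eqP.
  by rewrite finset.eqEsubset !sub.
have /p_natP : p.-nat #|lcosets M H|.
  apply: (@pnat_dvd _ #|T|).
    rewrite (card_lcosets (Group gH) (Group gM)) (dvdn_trans (dvdn_indexg _ _)) //.
    by rewrite -cardsT; exact: cardSg (finset.subsetT (Group gH)).
  have pfold l : all (pnat p) l -> p.-nat (foldr muln 1%N l).
    by elim: l => //= k l IH /andP[pk /IH]; rewrite pnatM pk.
  rewrite card_dep_ffun; apply: pfold; apply/allP => _ /mapP[j _ ->].
  by rewrite -cardsT; exact: pgT.
move=> [m mE]; exists m; rewrite NE.
apply: (card_eq_trans (inj_card_eq phiI)).
rewrite -mE (_ : [set` lcosets M H] = range (fun i : 'I_#|lcosets M H| => enum_val i)).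
  apply: card_eq_trans (card_esym card_II).
  by apply: inj_card_eq => i j _ _; exact: enum_val_inj.
apply/seteqP; split=> [C CH|_ [i _ <-]]; last exact: enum_valP.
by exists (enum_rank_in CH C); rewrite // enum_rankK_in.
Qed.

Lemma word_coordP w : word w ->
  forall s : seq I, exists2 w', word w' & {in s, forall i, w i = w' i}.
Proof. by move=> ww s; exists w. Qed.

Definition closedgen_word w (ww : word w) := ClosedGen (word_coordP ww).

Lemma word_closedgen w : word w -> exists x : closedgen, coord x = w.
Proof. by move=> ww; exists (closedgen_word ww). Qed.

(** Words are dense: near [x] both maps are controlled by finitely many coordinates, on which [x]
    agrees with a word. *)
Lemma closedgen_hom_eq (V : zmodType) (f g : closedgen -> V) :
  (forall x, \forall y \near x, f y = f x) ->
  (forall x, \forall y \near x, g y = g x) ->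
  (forall x y, f (x * y) = (f x + f y)%R) ->
  (forall x y, g (x * y) = (g x + g y)%R) ->
  (forall x : closedgen, S x -> f x = g x) -> f =1 g.
Proof.
move=> cf cg fM gM fg; have hom1 (h : closedgen -> V) :
    (forall x y, h (x * y) = (h x + h y)%R) -> h 1 = 0%R.
  by move=> /(_ 1 1); rewrite mulg1 => h1; apply: (addrI (h 1)); rewrite -h1 addr0.
have homV (h : closedgen -> V) :
    (forall x y, h (x * y) = (h x + h y)%R) -> forall x, h x^-1 = (- h x)%R.
  by move=> hM x; apply/eqP; rewrite -addr_eq0 -hM mulVg hom1.
have fgw w : word w -> forall x : closedgen, coord x = w -> f x = g x.
  elim=> [x x1|v Sv x xv|a b wa IHa wb IHb x xab|a wa IHa x xa].
  - by rewrite (_ : x = 1) ?hom1 //; apply: closedgen_ext => i; rewrite x1.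
  - by apply: fg; rewrite xv.
  - have [y ya] := word_closedgen wa; have [z zb] := word_closedgen wb.
    have -> : x = y * z by apply: closedgen_ext => i; rewrite xab /= ya zb.
    by rewrite fM gM (IHa y) ?(IHb z).
  - have [y ya] := word_closedgen wa.
    have -> : x = y^-1 by apply: closedgen_ext => i; rewrite xa /= ya.
    by rewrite !homV // (IHa y).
move=> x; have [s fs] := (nbhs_agree x _).1 (cf x).
have [t gt] := (nbhs_agree x _).1 (cg x).
have [w ww xw] := coordP x (s ++ t).
have [y yw] := word_closedgen ww.
have fy : f y = f x by apply: fs => i si; rewrite xw ?yw // mem_cat si.
have gy : g y = g x by apply: gt => i ti; rewrite xw ?yw // mem_cat ti orbT.
by rewrite -fy -gy; exact: fgw yw.
Qed.

End ClosedSubgroup.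

Local Open Scope classical_set_scope.
Local Open Scope quotient_scope.

(** * Cochains of degree one *)

Lemma pi_coboundary p (G : topologicalGroupType) n (z : cocycle p G n) :
  z \in @is_coboundary p G n -> \pi_(cohomology p G n) z = 0.
Proof.
move=> z0; rewrite -[RHS](raddf0 (\pi_(cohomology p G n))); apply/eqP.
by rewrite -Quotient.idealrBE subr0.
Qed.

Section DegreeOne.
Variables (p : nat) (G : topologicalGroupType).
Implicit Types (f h : cochain p G 1) (x y : G).

Definition eval1 f x : 'F_p := f (fun=> x).

Lemma eval1E f (g : 'I_1 -> G) : f g = eval1 f (g ord0).
Proof. by rewrite /eval1; congr (f _); apply/funext => i; rewrite ord1. Qed.

Lemma eval1_continuous f x : \forall y \near x, eval1 f y = eval1 f x.
Proof.
have cu : continuous ((fun x _ => x) : G -> {ptws 'I_1 -> G}).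
  by apply: continuous_ptws => i y; exact: cvg_id.
have /continuous_cochainP/(_ (fun=> x)) := cochain_funP f.
exact: cu.
Qed.

Lemma cochain1_subproof (a : G -> 'F_p) :
  (forall x, \forall y \near x, a y = a x) ->
  (fun g : 'I_1 -> G => a (g ord0)) \in @continuous_cochain p G 1.
Proof.
move=> ca; apply/continuous_cochainP => g.
exact: (@continuous_coord G 1 ord0 g _ (ca (g ord0))).
Qed.

Definition cochain1 (a : G -> 'F_p)
  (ca : forall x, \forall y \near x, a y = a x) : cochain p G 1 :=
  Cochain (cochain1_subproof ca).

Lemma differential1E f (g : 'I_2 -> G) :
  differential f g =
    eval1 f (g ord0) + eval1 f (g ord_max) - eval1 f (g ord0 * g ord_max)%g.
Proof.
rewrite /= /differential_fun !big_ord_recl big_ord0 /= !eval1E /face /= !expr0.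
rewrite mul1r mulN1r addr0 [(-1) ^+ _]mulrNN mulr1 mul1r.
rewrite (_ : lift ord0 _ = ord_max); last exact: val_inj.
rewrite (_ : widen_ord _ _ = ord0); last exact: val_inj.
by rewrite addrA addrC addrA.
Qed.

Lemma cup1E f h (g : 'I_2 -> G) :
  cup f h g = eval1 f (g ord0) * eval1 h (g ord_max).
Proof.
rewrite /= /cup_fun !eval1E; congr (eval1 f (g _) * eval1 h (g _)); exact: val_inj.
Qed.

Lemma cochain1_eq f h : eval1 f =1 eval1 h -> f = h.
Proof. by move=> fh; apply: cochain_eq => g; rewrite !eval1E. Qed.

(** Over F_2 the pointwise identity is the multiplication rule [entM] of unitriangular matrices,
    which links defining systems to homomorphisms. *)
Lemma differential1_eq f (I : Type) (s : seq I) (F H : I -> cochain p G 1) :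
  differential f = \sum_(i <- s) (cup (F i) (H i) : cochain p G 2) <->
  forall x y, eval1 f x + eval1 f y - eval1 f (x * y)%g =
    \sum_(i <- s) eval1 (F i) x * eval1 (H i) y.
Proof.
have sumE g : (\sum_(i <- s) (cup (F i) (H i) : cochain p G 2)) g =
    \sum_(i <- s) eval1 (F i) (g ord0) * eval1 (H i) (g ord_max).
  elim: s => [|i s IH]; first by rewrite !big_nil.
  by rewrite !big_cons -IH -cup1E.
split=> [df x y|df]; last first.
  by apply: cochain_eq => g; rewrite sumE differential1E df.
pose g (i : 'I_2) := if i == ord0 then x else y.
by have := sumE g; rewrite -df differential1E /g /=.
Qed.

Lemma cocycle1M f x y :
  differential f = 0 -> eval1 f (x * y)%g = eval1 f x + eval1 f y.
Proof.
move=> df; have /(differential1_eq f [::] (fun=> 0) (fun=> 0)).1/(_ x y) :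
    differential f = \sum_(i <- [::] : seq nat) (cup (0 : cochain p G 1) 0 : cochain p G 2).
  by rewrite big_nil.
by rewrite big_nil => /eqP; rewrite subr_eq0 => /eqP.
Qed.

(** The action is trivial, so both faces of a 0-cochain agree and cancel. Hence a class of degree 1
    has a single representative. *)
Lemma coboundary1 (z : cocycle p G 1) : z \in @is_coboundary p G 1 -> z = 0.
Proof.
move=> /asboolP[b db]; apply: cocycle_eq => g; rewrite -db.
rewrite /= /differential_fun !big_ord_recl big_ord0 /= expr0 mul1r expr1 mulN1r addr0.
apply/eqP; rewrite subr_eq0; apply/eqP; congr (b _).
by apply/funext => -[].
Qed.

Lemma represents_eq (f h : cochain p G 1) c :
  represents f c -> represents h c -> f = h.
Proof.
move=> [z <- zc] [w <- wc]; congr cocycle_cochain; apply/eqP; rewrite -subr_eq0.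
apply/eqP/coboundary1; rewrite Quotient.idealrBE zc wc //.
Qed.

End DegreeOne.

(** * The group *)

Inductive gen := GenB | GenC | GenE | GenF | GenU of nat | GenV of nat.

Definition gen_value n (t : relsys n) (g : gen) : UT n :=
  match g with
  | GenB => rb t | GenC => rc t | GenE => re t | GenF => rf t
  | GenU k => ru t k | GenV k => rv t k
  end.

Definition relindex : Type := {n & relsys n}.
HB.instance Definition _ := gen_eqMixin relindex.
HB.instance Definition _ := gen_choiceMixin relindex.

Definition coord_group (t : relindex) : finGroupType := UT (tag t).

Definition gen_coord (g : gen) : forall t, coord_group t :=
  fun t => gen_value (tagged t) g.

(* Every relsys is a coordinate of G, so it is automatically the value on the
   generators of a continuous homomorphism (coordG). *)
Definition relG : topologicalGroupType :=
  @closedgen relindex coord_group (range gen_coord).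

Lemma gen_coord_word g : word (range gen_coord) (gen_coord g).
Proof. by apply: word_gen; exists g. Qed.

Definition genG (g : gen) : relG := closedgen_word (gen_coord_word g).

Definition coordG n (t : relsys n) (x : relG) : UT n :=
  (x : @closedgen relindex coord_group (range gen_coord)) (Tagged relsys t).

Lemma coordG_gen n (t : relsys n) g : coordG t (genG g) = gen_value t g.
Proof. by []. Qed.

Lemma coordGM n (t : relsys n) x y : coordG t (x * y)%g = (coordG t x * coordG t y)%g.
Proof. by []. Qed.

Lemma coordG1 n (t : relsys n) : coordG t 1%g = 1%g.
Proof. by []. Qed.

Lemma coordG_prod n (t : relsys n) (J : Type) (s : seq J) (F : J -> relG) :
  coordG t (\prod_(j <- s) F j)%g = (\prod_(j <- s) coordG t (F j))%g.
Proof. exact: (big_morph _ (coordGM t) (coordG1 t)). Qed.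

Lemma coordG_exp n (t : relsys n) x m : coordG t (x ^+ m)%g = (coordG t x ^+ m)%g.
Proof. by elim: m => // m IH; rewrite !expgS coordGM IH. Qed.

Lemma relG_ext (x y : relG) : (forall n (t : relsys n), coordG t x = coordG t y) -> x = y.
Proof. by move=> xy; apply: closedgen_ext => -[n t]; exact: xy. Qed.

Lemma relG_nbhs_eventually (x : relG) (y : nat -> relG) A : nbhs x A ->
  (forall n (t : relsys n), exists m, forall k, (m <= k)%N ->
     coordG t (y k) = coordG t x) ->
  exists m, forall k, (m <= k)%N -> A (y k).
Proof. by move=> xA yx; apply: (nbhs_eventually xA) => -[n t]; exact: yx. Qed.

Lemma coordG_continuous n (t : relsys n) (x : relG) :
  \forall y \near x, coordG t y = coordG t x.
Proof.
apply/nbhs_agree; exists [:: Tagged relsys t] => y xy.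
by rewrite /coordG -xy ?mem_head.
Qed.

Lemma prod_bounded n (w : nat -> UT n) K N :
  (forall k, (K <= k)%N -> w k = 1%g) -> (K <= N)%N ->
  (\prod_(0 <= k < N) (w k * w k) = \prod_(0 <= k < K) (w k * w k))%g.
Proof.
move=> w1 KN; rewrite (@big_cat_nat _ _ _ K) //= [X in (_ * X)%g]big_nat.
by rewrite [X in (_ * X)%g]big1 ?mulg1 // => k /andP[Kk _]; rewrite w1 ?mulg1.
Qed.

(** The infinite product of the squares is expressed as a limit: at each coordinate [t] the partial
    products are constant from [rbound t] on. *)
Lemma relG_ce (A : set relG) : nbhs (genG GenC * genG GenE)%g A ->
  exists m, forall N, (m <= N)%N -> A (genG GenE * genG GenC *
    \prod_(0 <= k < N) (genG (GenU k) * genG (GenU k)))%g.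
Proof.
move=> cA; apply: (relG_nbhs_eventually cA) => n t; exists (rbound t) => N tN.
rewrite !coordGM coordG_prod !coordG_gen /= rel_ce; congr (_ * _)%g.
by rewrite -(prod_bounded (ru_fin (r := t)) tN); exact: eq_bigr.
Qed.

Lemma relG_bf (A : set relG) : nbhs (genG GenB * genG GenF)%g A ->
  exists m, forall N, (m <= N)%N -> A (genG GenF * genG GenB *
    \prod_(0 <= k < N) (genG (GenV k) * genG (GenV k)))%g.
Proof.
move=> cA; apply: (relG_nbhs_eventually cA) => n t; exists (rbound t) => N tN.
rewrite !coordGM coordG_prod !coordG_gen /= rel_bf; congr (_ * _)%g.
by rewrite -(prod_bounded (rv_fin (r := t)) tN); exact: eq_bigr.
Qed.

Lemma relG_ef : (genG GenB * genG GenC * genG GenF = genG GenC * genG GenB * genG GenE)%g.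
Proof. by apply: relG_ext => n t; rewrite !coordGM !coordG_gen /= rel_ef. Qed.

Lemma relG_u (A : set relG) : nbhs 1%g A ->
  exists m, forall k, (m <= k)%N -> A (genG (GenU k)).
Proof.
move=> A1; apply: (relG_nbhs_eventually A1) => n t; exists (rbound t) => k tk.
by rewrite coordG_gen /= ru_fin.
Qed.

Lemma relG_v (A : set relG) : nbhs 1%g A ->
  exists m, forall k, (m <= k)%N -> A (genG (GenV k)).
Proof.
move=> A1; apply: (relG_nbhs_eventually A1) => n t; exists (rbound t) => k tk.
by rewrite coordG_gen /= rv_fin.
Qed.

Lemma relG_exp2 (x : relG) A : nbhs 1%g A -> exists k, A (x ^+ (2 ^ k))%g.
Proof.
move=> A1.
have [m mA] : exists m, forall k, (m <= k)%N -> A (x ^+ (2 ^ k))%g; last first.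
  by exists m; exact: mA.
apply: (relG_nbhs_eventually A1) => n t; exists n => k nk.
by rewrite coordG_exp UT_exp2.
Qed.

Lemma relG_pro_2 : pro_p_group 2 relG.
Proof. by apply: closedgen_pro_p => t; exact: UT_pgroup. Qed.

(** A cocycle [h] is a locally constant homomorphism. As the powers [x ^+ (2 ^ k)] tend to 1, some
    [2 ^ k] times [h x] is zero, and 2 is invertible modulo [p]. *)
Lemma relG_cocycle1_odd p (z : cocycle p relG 1) : prime p -> p != 2 -> z = 0.
Proof.
move=> p_pr p2; apply: cocycle_eq => g; rewrite eval1E.
set x := g ord0; set h := eval1 z.
have hM y1 y2 : h (y1 * y2)%g = h y1 + h y2.
  by apply: cocycle1M; exact/eqP/(cocycle_cochainP z).
have h1 : h 1%g = 0.
  by apply: (addrI (h 1%g)); rewrite -hM mulg1 addr0.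
have hX m : h (x ^+ m)%g = h x *+ m.
  by elim: m => [|m IH]; rewrite ?expg0 ?h1 // expgS hM IH mulrS.
have [k hk] := relG_exp2 x (eval1_continuous z 1%g).
move: hk; rewrite /= -/h hX h1 -mulr_natr => /eqP; rewrite mulf_eq0 => /orP[/eqP->//|].
have pch : p \in [pchar 'F_p] by rewrite pchar_Fp.
rewrite -(dvdn_pcharf pch) Euclid_dvdX // => /andP[].
by rewrite dvdn_prime2 // (negPf p2).
Qed.

Lemma relG_massey_odd p n (a : 'I_n -> cohomology p relG 1) :
  prime p -> p != 2 -> massey_vanishes a.
Proof.
move=> p_pr p2.
have cup0 (I : Type) (s : seq I) :
    \sum_(k <- s) cup (0 : cochain p relG 1) 0 = 0 :> cochain p relG 2.
  rewrite big1 // => k _; apply: cochain_eq => g; rewrite cup1E /eval1.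
  exact: mul0r.
exists (fun _ _ => 0).
  split=> [i j _ _|i]; first by rewrite raddf0 cup0.
  exists 0 => //; rewrite -[RHS]reprK; congr (\pi _); symmetry.
  exact: relG_cocycle1_odd.
rewrite cup0; exists 0 => //; exact: raddf0.
Qed.

(** * Defining systems as homomorphisms modulo the corner *)

Section Representation.
Variables (n : nat) (a : 'I_n -> cohomology 2 relG 1) (A : nat -> nat -> cochain 2 relG 1).
Hypothesis dA : defining_system a A.

(** No differential condition is imposed on [A 0 n], so multiplicativity ([repM]) holds modulo the
    corner only. *)
Definition rep (x : relG) : UT n := mkUT n (fun i j => eval1 (A i j) x).

Lemma rep_continuous x : \forall y \near x, rep y = rep x.
Proof.
have cA (ij : 'I_n.+1 * 'I_n.+1) :
    \forall y \near x, eval1 (A ij.1 ij.2) y = eval1 (A ij.1 ij.2) x.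
  exact: eval1_continuous.
apply: (@filterS _ (nbhs x) _ _ _ _ (@filter_forall _ _ _ (nbhs x) _ cA)).
move=> y yx; apply: ent_ext => i j ijn; rewrite !ent_mkUT //.
have /andP[ij jn] := ijn; have i_n := leq_trans (ltnW ij) jn.
exact: (yx (Ordinal (i_n : i < n.+1)%N, Ordinal (jn : j < n.+1)%N)).
Qed.

Lemma repM x y : eqmodZ (rep (x * y)%g) (rep x * rep y)%g.
Proof.
move=> i j ijn ij0; rewrite entM // !ent_mkUT //.
have /differential1_eq/(_ x y) h := dA.1 i j ijn ij0.
set s := eval1 (A i j) x + eval1 (A i j) y in h *.
have -> : eval1 (A i j) (x * y)%g = s + (s - eval1 (A i j) (x * y)%g).
  by rewrite addrA F2_addrr add0r F2_oppr.
rewrite h; congr (_ + _); apply: eq_big_nat => k /andP[ik kj].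
have /andP[ij jn] := ijn.
by rewrite !ent_mkUT ?ik ?kj //= (leq_trans (ltnW kj)).
Qed.

Lemma rep1 : eqmodZ (rep 1%g) 1%g.
Proof.
have := @repM 1%g 1%g; rewrite mulg1 => /eqmodZ_corner[c h].
have {h} : (1 = rep 1 * corner n c)%g.
  by apply: (mulgI (rep 1%g)); rewrite mulg1 mulgA.
by move=> {1}->; apply: eqmodZ_sym; exact: eqmodZ_mul_corner.
Qed.

Lemma rep_prod (J : Type) (s : seq J) (F : J -> relG) :
  eqmodZ (rep (\prod_(j <- s) F j)%g) (\prod_(j <- s) rep (F j))%g.
Proof.
elim: s => [|j s IH]; first by rewrite !big_nil; exact: rep1.
by rewrite !big_cons; apply: eqmodZ_trans (repM _ _) _; apply: eqmodZM.
Qed.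

(** Since [rep] is locally constant, it takes the same value at a limit and at all late partial
    products; [K] exceeds the thresholds of both relations and of the convergence of [u_k] and [v_k]
    to 1. *)
Lemma rep_relations : exists K,
  [/\ eqmodZ (rep (genG GenC) * rep (genG GenE))%g
        (rep (genG GenE) * rep (genG GenC) *
         \prod_(0 <= k < K) (rep (genG (GenU k)) * rep (genG (GenU k))))%g,
      eqmodZ (rep (genG GenB) * rep (genG GenF))%g
        (rep (genG GenF) * rep (genG GenB) *
         \prod_(0 <= k < K) (rep (genG (GenV k)) * rep (genG (GenV k))))%g,
      eqmodZ (rep (genG GenB) * rep (genG GenC) * rep (genG GenF))%g
        (rep (genG GenC) * rep (genG GenB) * rep (genG GenE))%g
    & forall k, (K <= k)%N ->
        eqmodZ (rep (genG (GenU k))) 1%g /\ eqmodZ (rep (genG (GenV k))) 1%g].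
Proof.
have [m1 ce] := relG_ce (rep_continuous _); have [m2 bf] := relG_bf (rep_continuous _).
have [m3 u1] := relG_u (rep_continuous 1%g); have [m4 v1] := relG_v (rep_continuous 1%g).
pose K := maxn (maxn m1 m2) (maxn m3 m4).
have /and4P[K1 K2 K3 K4] : [&& m1 <= K, m2 <= K, m3 <= K & m4 <= K]%N.
  by rewrite /K !leq_max !leqnn !orbT.
have sq N (w : nat -> gen) : eqmodZ
    (rep (\prod_(0 <= k < N) (genG (w k) * genG (w k))))%g
    (\prod_(0 <= k < N) (rep (genG (w k)) * rep (genG (w k))))%g.
  apply: eqmodZ_trans (rep_prod _ _) _; apply: eqmodZ_prod => k; exact: repM.
exists K; split=> [|||k Kk].
- apply: eqmodZ_trans (eqmodZ_sym (@repM _ _)) _; rewrite -(ce K K1).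
  apply: eqmodZ_trans (@repM _ _) _; apply: eqmodZM (sq _ _); exact: repM.
- apply: eqmodZ_trans (eqmodZ_sym (@repM _ _)) _; rewrite -(bf K K2).
  apply: eqmodZ_trans (@repM _ _) _; apply: eqmodZM (sq _ _); exact: repM.
- apply: (eqmodZ_trans (y := rep (genG GenB * genG GenC * genG GenF)%g)).
    apply: eqmodZ_sym; apply: eqmodZ_trans (@repM _ _) _.
    by apply: eqmodZM => //; exact: repM.
  rewrite relG_ef; apply: eqmodZ_trans (@repM _ _) _.
  by apply: eqmodZM => //; exact: repM.
- split; first by rewrite /= (u1 k (leq_trans K3 Kk)); exact: rep1.
  by rewrite /= (v1 k (leq_trans K4 Kk)); exact: rep1.
Qed.

End Representation.

(** * From homomorphisms back to cochains *)

Definition entry_cochain n (t : relsys n) (i j : nat) : cochain 2 relG 1 :=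
  cochain1 (fun x : relG => @filterS _ (nbhs x) _ _ _ (fun y (yx : coordG t y = coordG t x) =>
    congr1 (fun z => ent z i j) yx) (coordG_continuous t x)).

Lemma eval1_entry n (t : relsys n) i j x :
  eval1 (entry_cochain t i j) x = ent (coordG t x) i j.
Proof. by []. Qed.

Lemma differential_entry n (t : relsys n) i j : (i < j <= n)%N ->
  differential (entry_cochain t i j) =
    \sum_(i.+1 <= k < j) cup (entry_cochain t i k) (entry_cochain t k j).
Proof.
move=> ijn; apply/differential1_eq => x y; rewrite !eval1_entry coordGM entM //.
by rewrite opprD addrA subrr add0r F2_oppr.
Qed.

Lemma cochain1_hom_eq (f h : cochain 2 relG 1) :
  differential f = 0 -> differential h = 0 ->
  (forall g, eval1 f (genG g) = eval1 h (genG g)) -> f = h.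
Proof.
move=> df dh fh; apply: cochain1_eq.
apply: (closedgen_hom_eq (eval1_continuous f) (eval1_continuous h)) =>
  [x y|x y|]; [exact: cocycle1M..|].
move=> x [g _ xg]; suff -> : x = genG g by exact: fh.
by apply: closedgen_ext => t; rewrite -xg.
Qed.

(** The entries of [coordG t] form a defining system for the same classes, since characters agreeing
    on generators are equal. Its entry [(0, n)] is a cochain bounding the Massey product. *)
Lemma massey_vanishes_relsys n (a : 'I_n -> cohomology 2 relG 1) A (t : relsys n) :
  (2 < n)%N -> defining_system a A ->
  (forall g, eqdiag (gen_value t g) (rep n A (genG g))) -> massey_vanishes a.
Proof.
move=> n2 dA tA; have AE (i : 'I_n) : entry_cochain t i i.+1 = A i i.+1.
  have ltin := ltn_ord i.
  apply: cochain1_hom_eq.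
  - by rewrite differential_entry ?ltnS ?leqnn // big_geq.
  - rewrite dA.1 ?ltnS ?leqnn ?big_geq // xpair_eqE negb_and.
    by case: (i : nat) => //=; rewrite ltn_eqF // ltnW.
  - by move=> g; rewrite eval1_entry coordG_gen tA // ent_mkUT // ltnS leqnn.
have dt : defining_system a (entry_cochain t).
  split=> [i j ijn _|i]; first exact: differential_entry.
  by rewrite AE; exact: dA.2.
exists (entry_cochain t) => //.
have /eqP zP := massey_cocycle dt.
exists (Cocycle zP) => //; apply: pi_coboundary; apply/asboolP.
by exists (entry_cochain t 0 n); rewrite differential_entry // leqnn (ltnW (ltnW n2)).
Qed.

Lemma relG_weak_massey_2 n : (3 <= n)%N -> weak_massey_vanishing 2 relG n.
Proof.
move=> n3 a [A dA]; have [K [ce bf ef uv1]] := rep_relations dA.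
have [t [[tb tc te tf] tuv]] : exists t, lifts
    (rep n A (genG GenB)) (rep n A (genG GenC)) (rep n A (genG GenE))
    (rep n A (genG GenF)) (fun k => rep n A (genG (GenU k)))
    (fun k => rep n A (genG (GenV k))) K t.
  move: n3; rewrite leq_eqVlt => /orP[/eqP n3|n4]; last exact: lift_ge4.
  by case: n / n3 a dA ce bf ef uv1 => a dA ce bf ef _; exact: lift_3.
(* For [k >= K] the lifted values have zero superdiagonal, and so do those of [rep], being trivial
   modulo the corner. *)
apply: (massey_vanishes_relsys (t := t) n3 dA) => -[||||k|k] //= i lin.
- rewrite (tuv k).1 //; case: ltnP => // Kk.
  by apply/esym/(eqmodZ_diag (ltnW n3) (uv1 k Kk).1).
- rewrite (tuv k).2 //; case: ltnP => // Kk.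
  by apply/esym/(eqmodZ_diag (ltnW n3) (uv1 k Kk).2).
Qed.

(** * The classes violating strong Massey vanishing *)

Definition character (b c : 'F_2) : cochain 2 relG 1 :=
  entry_cochain (relsys2 b 0 c 0) 0 1.

Lemma character_cocycle b c : character b c \in @is_cocycle 2 relG 1.
Proof. by apply/eqP; rewrite differential_entry // big_geq. Qed.

Definition character_class b c : cohomology 2 relG 1 :=
  \pi_(cohomology 2 relG 1) (Cocycle (character_cocycle b c)).

Lemma eval1_character b c g : eval1 (character b c) (genG g) =
  match g with GenB => b | GenC => c | _ => 0 end.
Proof.
by rewrite eval1_entry coordG_gen; case: g => [||||k|k] /=;
  rewrite ?ent_mkUT ?ent1 ?ent_corner.
Qed.

(** The cup product is the differential of the entry (0, 2) of the homomorphism given by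
    [relsys2]. *)
Lemma cup_character b0 c0 b1 c1 :
  cup_cohomology (character_class b0 c0) (character_class b1 c1) = 0.
Proof.
rewrite pi_cup; apply: pi_coboundary; apply/asboolP.
exists (entry_cochain (relsys2 b0 b1 c0 c1) 0 2).
have entryE i b c : (i < 2)%N -> (forall g, ent (gen_value (relsys2 b0 b1 c0 c1) g) i i.+1 =
    match g with GenB => b | GenC => c | _ => 0 end) ->
    entry_cochain (relsys2 b0 b1 c0 c1) i i.+1 = character b c.
  move=> i2 ti; apply: cochain1_hom_eq.
  - by rewrite differential_entry ?ltnS ?leqnn // big_geq.
  - exact/eqP/character_cocycle.
  - by move=> g; rewrite eval1_character eval1_entry coordG_gen ti.
rewrite differential_entry // big_nat1 (entryE 0%N b0 c0) // ?(entryE 1%N b1 c1) //.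
- by case=> [||||k|k] /=; rewrite ?ent_mkUT ?ent1 ?ent_corner.
- by case=> [||||k|k] /=; rewrite ?ent_mkUT ?ent1 ?ent_corner.
Qed.

Lemma relG_not_strong_massey : ~ strong_massey_vanishing 2 relG 4.
Proof.
(* The values on [b] and [c] of the sequence x + y, x, y, x + y. *)
pose bs i : 'F_2 := if i == 2%N then 0 else 1.
pose cs i : 'F_2 := if i == 1%N then 0 else 1.
pose a (i : 'I_4) := character_class (bs i) (cs i).
(* The contradiction comes from the defining system itself: this Massey product is not even
   defined. *)
move=> /(_ a (fun i j _ => cup_character _ _ _ _))[A dA _].
have AE i : (i < 4)%N -> A i i.+1 = character (bs i) (cs i).
  move=> i4; apply: (represents_eq (dA.2 (Ordinal i4))).
  by exists (Cocycle (character_cocycle (bs i) (cs i))).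
have repE g i : (i < 4)%N -> ent (rep 4 A (genG g)) i i.+1 =
    match g with GenB => bs i | GenC => cs i | _ => 0 end.
  by move=> i4; rewrite ent_mkUT ?leqnn // AE // eval1_character.
have [K [ce bf ef _]] := rep_relations dA.
apply: (no_relsys4 ce bf ef); rewrite ?repE //.
- by move=> i i4; rewrite repE // ent1 // leqnn.
- by move=> k i i4; rewrite repE // ent1 // leqnn.
- by move=> k i i4; rewrite repE // ent1 // leqnn.
Qed.

Local Open Scope nat_scope.

Theorem theorem1p10 :
  exists G : topologicalGroupType,
    [/\ pro_p_group 2 G,
        (forall n p : nat, 3 <= n -> prime p -> weak_massey_vanishing p G n)
      & ~ strong_massey_vanishing 2 G 4].
Proof.
exists relG; split; [exact: relG_pro_2| |exact: relG_not_strong_massey].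
move=> n p n3 p_pr; have [->|p2] := eqVneq p 2; first exact: relG_weak_massey_2.
by move=> a _; exact: relG_massey_odd.
Qed.
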